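(* Let $\mathbb{X}\subseteq\mathbb{P}^2$ be a $\Bbbk$-configuration of type $(1,2,\dots,s)$ with $s\ge2$, and assume there are exactly $r$ lines in $\mathbb{P}^2$ containing $s$ points of $\mathbb{X}$, where $1\le r<s$. Then $\Delta\mathbf{H}_{m\mathbb{X}}(ms-1)=r$ for all integers $m\ge s+1$.
   Context: $\Bbbk$ is an algebraically closed field and $R=\Bbbk[x_0,x_1,x_2]$. A $\Bbbk$-configuration of type $(d_1,\dots,d_s)$ is a finite set $\mathbb{X}\subseteq\mathbb{P}^2$ for which there exist integers $1\le d_1<\cdots<d_s$, subsets $\mathbb{X}_1,\dots,\mathbb{X}_s$ of $\mathbb{X}$ and distinct lines $\mathbb{L}_1,\dots,\mathbb{L}_s\subseteq\mathbb{P}^2$ such that (1) $\mathbb{X}=\bigcup_{i=1}^s\mathbb{X}_i$; (2) $|\mathbb{X}_i|=d_i$ and $\mathbb{X}_i\subseteq\mathbb{L}_i$ for each $i$; (3) for $1<i\le s$, $\mathbb{L}_i$ contains no point of $\mathbb{X}_j$ for any $j<i$. For $\mathbb{X}=\{P_1,\dots,P_n\}$ and $m\ge1$, $m\mathbb{X}$ is the fat point scheme with ideal $I_{m\mathbb{X}}=I_{P_1}^m\cap\cdots\cap I_{P_n}^m$, where $I_P$ is the ideal of $P$. $\mathbf{H}_\mathbb{Z}(t)=\dim_\Bbbk R_t-\dim_\Bbbk(I_\mathbb{Z})_t$ and $\Delta\mathbf{H}_\mathbb{Z}(t)=\mathbf{H}_\mathbb{Z}(t)-\mathbf{H}_\mathbb{Z}(t-1)$,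 with $\mathbf{H}_\mathbb{Z}(t)=0$ for $t<0$. *)

(* Defs.v *)
From HB Require Import structures.
From mathcomp Require Import all_boot all_order all_algebra.
From Stdlib Require Import ClassicalEpsilon.
Set Implicit Arguments. Unset Strict Implicit. Unset Printing Implicit Defensive.
Import Order.TTheory GRing.Theory Num.Theory.
Local Open Scope ring_scope.

Section Defs.
Variable K : closedFieldType.

(* A triple ((x0, x1), x2) of homogeneous coordinates; also used for
   lines a0 x0 + a1 x1 + a2 x2 = 0. *)
Definition triple := (K * K * K)%type.
Definition tnz (p : triple) : bool := p != (0, 0, 0).
Definition samept (p q : triple) : Prop :=
  exists c : K, c != 0 /\ q = (c * p.1.1, c * p.1.2, c * p.2).
Definition onLine (l p : triple) : bool :=
  l.1.1 * p.1.1 + l.1.2 * p.1.2 + l.2 * p.2 == 0.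

(* A finite set of points of P^2: a list of nonzero representatives,
   pairwise representing distinct points. *)
Definition ptset (X : seq triple) : Prop :=
  (forall p, p \in X -> tnz p) /\
  (forall i j, (i < size X)%N -> (j < size X)%N -> i <> j ->
     ~ samept (nth (0,0,0) X i) (nth (0,0,0) X j)).

Definition kconfig (X : seq triple) (ds : seq nat) : Prop :=
  ptset X /\ (0 < size ds)%N /\ (0 < head 0%N ds)%N /\ sorted ltn ds /\
  exists (Xs : seq (seq triple)) (Ls : seq triple),
    size Xs = size ds /\ size Ls = size ds /\
    (forall p, p \in X -> exists2 i, (i < size ds)%N & p \in nth [::] Xs i) /\
    (forall i p, (i < size ds)%N -> p \in nth [::] Xs i -> p \in X) /\
    (forall i, (i < size ds)%N ->
       uniq (nth [::] Xs i) /\ size (nth [::] Xs i) = nth 0%N ds i /\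
       tnz (nth (0,0,0) Ls i) /\
       (forall p, p \in nth [::] Xs i -> onLine (nth (0,0,0) Ls i) p)) /\
    (forall i j, (i < size ds)%N -> (j < size ds)%N -> i <> j ->
       ~ samept (nth (0,0,0) Ls i) (nth (0,0,0) Ls j)) /\
    (forall i j p, (j < i)%N -> (i < size ds)%N -> p \in nth [::] Xs j ->
       ~~ onLine (nth (0,0,0) Ls i) p).

Definition nOnLine (X : seq triple) (l : triple) : nat := count (onLine l) X.

Definition exactly_lines_with (X : seq triple) (k r : nat) : Prop :=
  exists Ls : seq triple,
    size Ls = r /\
    (forall l, l \in Ls -> tnz l /\ nOnLine X l = k) /\
    (forall i j, (i < r)%N -> (j < r)%N -> i <> j ->
       ~ samept (nth (0,0,0) Ls i) (nth (0,0,0) Ls j)) /\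
    (forall l, tnz l -> nOnLine X l = k -> exists2 l', l' \in Ls & samept l' l).

(* R = K[x0,x1,x2], represented as {poly {poly {poly K}}}:
   x0 = 'X%:P%:P (innermost), x1 = 'X%:P, x2 = 'X (outermost). *)
Definition R3 := {poly {poly {poly K}}}.
Definition coef3 (F : R3) (a b c : nat) : K := ((F`_c)`_b)`_a.
Definition homog (F : R3) (d : nat) : Prop :=
  forall a b c, coef3 F a b c != 0 -> (a + b + c)%N = d.
Definition eval3 (F : R3) (p : triple) : K :=
  (F.[(p.2)%:P%:P]).[(p.1.2)%:P].[p.1.1].
Definition scal3 (c : K) : R3 := c%:P%:P%:P.

Definition inIdeal (S : R3 -> Prop) (F : R3) : Prop :=
  exists gs cs : seq R3, size cs = size gs /\
    (forall i, (i < size gs)%N -> S (nth 0 gs i)) /\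
    F = \sum_(i < size gs) nth 0 cs i * nth 0 gs i.

Definition genIP (p : triple) (G : R3) : Prop :=
  exists d, homog G d /\ eval3 G p = 0.
Definition genIPm (p : triple) (m : nat) (G : R3) : Prop :=
  exists gs : seq R3, size gs = m /\
    (forall i, (i < m)%N -> genIP p (nth 0 gs i)) /\ G = \prod_(g <- gs) g.
Definition inIfat (X : seq triple) (m : nat) (F : R3) : Prop :=
  forall p, p \in X -> inIdeal (genIPm p m) F.

Definition linindep (fs : seq R3) : Prop :=
  forall cs : seq K, size cs = size fs ->
    \sum_(i < size fs) scal3 (nth 0 cs i) * nth 0 fs i = 0 ->
    forall i, (i < size fs)%N -> nth 0 cs i = 0.

Definition decideP (P : Prop) : bool :=
  if excluded_middle_informative P then true else false.

(* dimension of a K-subspace V of R_t: the maximal number of linearly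
   independent elements of V ((t+2)^2 is a safe upper bound of dim R_t) *)
Definition dimdeg (t : nat) (V : R3 -> Prop) : nat :=
  \max_(n < ((t + 2) ^ 2).+1 |
        decideP (exists fs : seq R3, size fs = n /\
                   (forall i, (i < n)%N -> V (nth 0 fs i)) /\ linindep fs)) n.

Definition HF (IZ : R3 -> Prop) (t : nat) : nat :=
  (dimdeg t (fun F => homog F t) - dimdeg t (fun F => homog F t /\ IZ F))%N.

(* Delta H(t) = H(t) - H(t-1), with H(-1) = 0 *)
Definition DeltaHF (IZ : R3 -> Prop) (t : nat) : int :=
  if t is t'.+1 then (HF IZ t)%:Z - (HF IZ t')%:Z else (HF IZ 0)%:Z.

End Defs.

(* Main.v *)
(* Write b for degree + 1, and for multiplicities mu on X let d(mu, b) be the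
   dimension of the space of forms of degree b - 1 vanishing to order mu p at
   every p in X.  Restriction to a line L and division by L give
     d(mu - 1_L, b) <= d(mu, b+1) <= d(mu - 1_L, b) + (b + 1 - sum_(p on L) mu p),
   where the subtraction is truncated.  If sum_(p on L) mu p >= b + 1, then L
   splits off every form; if sum_(p on L) mu p <= b + 1, then mu imposes
   independent conditions for b + 1 as soon as mu - 1_L does for b.

   Let L_1, ..., L_r be the lines with s points.  Any two of them meet in at
   most one point of X, so all of them split off the forms of degree m s - 1 and
   m s - 2.  What is left has multiplicity m - 1 or less on the L_i and m
   elsewhere, and imposes independent conditions in degree m s - r - 2: a
   second pass over the L_i, followed by a second covering of the remaining
   points by lines, lowers all multiplicities to m - 2, and one line is saved
   because the last three points, which form a triangle, are covered twice by
   its three sides instead of by four lines.  From there on, lines carrying s,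
   s - 1, ..., 1 new points, used m - 2 times each, suffice.  The two dimensions
   then differ by m s - r, whereas those of the full spaces of forms differ by
   m s. *)
Require Import Defs.
From HB Require Import structures.
From mathcomp Require Import all_boot all_order all_algebra.
From mathcomp Require Import zify ring.
From Stdlib Require Import ClassicalEpsilon.
Import Order.TTheory GRing.Theory Num.Theory.
Local Open Scope ring_scope.
Set Implicit Arguments. Unset Strict Implicit. Unset Printing Implicit Defensive.

(** * Substitution of linear forms *)

Section Substitution.
Variable K : closedFieldType.
Notation R3 := (R3 K).
Notation triple := (triple K).
Notation scal3 := (@scal3 K).

HB.instance Definition _ :=
  GRing.RMorphism.copy scal3 (polyC \o polyC \o polyC).

Lemma scal3_0 : scal3 0 = 0. Proof. by rewrite /Defs.scal3 !polyC0. Qed.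
Lemma scal3_1 : scal3 1 = 1. Proof. by rewrite /Defs.scal3 !polyC1. Qed.
Lemma scal3D : {morph scal3 : x y / x + y}.
Proof. by move=> x y; rewrite /Defs.scal3 !polyCD. Qed.
Lemma scal3M : {morph scal3 : x y / x * y}.
Proof. by move=> x y; rewrite /Defs.scal3 !polyCM. Qed.

Definition x0 : R3 := 'X%:P%:P.
Definition x1 : R3 := 'X%:P.
Definition x2 : R3 := 'X.

Lemma commr_com (A : nzRingType) (S : comNzRingType) (f : {rmorphism A -> S}) (u : S) :
  commr_rmorph f u.
Proof. by move=> x; apply: mulrC. Qed.

Definition hmorph (A : nzRingType) (S : comNzRingType) (f : {rmorphism A -> S}) (u : S) :
  {rmorphism {poly A} -> S} := horner_morph (commr_com f u).

Lemma hmorphC (A : nzRingType) (S : comNzRingType) (f : {rmorphism A -> S}) u a :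
  hmorph f u a%:P = f a.
Proof. exact: horner_morphC. Qed.

Lemma hmorphX (A : nzRingType) (S : comNzRingType) (f : {rmorphism A -> S}) u :
  hmorph f u 'X = u.
Proof. exact: horner_morphX. Qed.

(** The evaluation map of the universal property of K[x0,x1,x2]. The target is any commutative ring,
    so evaluation at a point, restriction to a line and linear changes of coordinates are all
    instances. *)
Definition sub3 (S : comNzRingType) (phi : {rmorphism K -> S}) (u0 u1 u2 : S) :
  {rmorphism R3 -> S} := hmorph (hmorph (hmorph phi u0) u1) u2.

Lemma sub3C (S : comNzRingType) (phi : {rmorphism K -> S}) u0 u1 u2 c :
  sub3 phi u0 u1 u2 (scal3 c) = phi c.
Proof. by rewrite /sub3 !hmorphC. Qed.

Lemma sub3x0 (S : comNzRingType) (phi : {rmorphism K -> S}) u0 u1 u2 :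
  sub3 phi u0 u1 u2 x0 = u0.
Proof. by rewrite /sub3 /x0 !hmorphC hmorphX. Qed.

Lemma sub3x1 (S : comNzRingType) (phi : {rmorphism K -> S}) u0 u1 u2 :
  sub3 phi u0 u1 u2 x1 = u1.
Proof. by rewrite /sub3 /x1 !hmorphC hmorphX. Qed.

Lemma sub3x2 (S : comNzRingType) (phi : {rmorphism K -> S}) u0 u1 u2 :
  sub3 phi u0 u1 u2 x2 = u2.
Proof. by rewrite /sub3 /x2 hmorphX. Qed.

Definition sub3E := (sub3C, sub3x0, sub3x1, sub3x2).

(** Uniqueness in the universal property, by induction on each of the three nested polynomial
    layers. It reduces identities between composite substitutions to constants and variables. *)
Lemma rmorph3_eq (S : nzRingType) (f g : {rmorphism R3 -> S}) :
  (forall c, f (scal3 c) = g (scal3 c)) -> f x0 = g x0 -> f x1 = g x1 ->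
  f x2 = g x2 -> f =1 g.
Proof.
move=> eC e0 e1 e2 F; elim/poly_ind: F => [|F c IH]; first by rewrite !rmorph0.
rewrite !rmorphD !rmorphM /= IH -/x2 e2; congr (_ + _).
elim/poly_ind: c => [|G c IH']; first by rewrite !rmorph0.
rewrite !polyCD !polyCM !rmorphD !rmorphM /= IH' -/x1 e1; congr (_ + _).
elim/poly_ind: c => [|H c IH'']; first by rewrite !rmorph0.
by rewrite !polyCD !polyCM !rmorphD !rmorphM /= IH'' -/x0 e0 eC.
Qed.

Lemma eval3E (F : R3) (p : triple) : eval3 F p = sub3 idfun p.1.1 p.1.2 p.2 F.
Proof.
pose g : {rmorphism R3 -> K} :=
  horner_eval p.1.1 \o (horner_eval (p.1.2)%:P \o horner_eval (p.2)%:P%:P).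
have -> : eval3 F p = g F by [].
apply: rmorph3_eq; rewrite ?sub3E /g /= /horner_eval.
- by move=> c; rewrite sub3C /Defs.scal3 !hornerC.
- by rewrite /x0 !hornerC hornerX.
- by rewrite /x1 !hornerC hornerX hornerC.
- by rewrite /x2 hornerX !hornerC.
Qed.

Lemma sub3_comp (S T : comNzRingType) (phi : {rmorphism K -> S})
   (chi : {rmorphism S -> T}) (psi : {rmorphism K -> T}) u0 u1 u2 F :
  (forall c, chi (phi c) = psi c) ->
  chi (sub3 phi u0 u1 u2 F) = sub3 psi (chi u0) (chi u1) (chi u2) F.
Proof.
move=> e; rewrite -[LHS]/((chi \o sub3 phi u0 u1 u2) F).
by apply: rmorph3_eq => [c|||] /=; rewrite !sub3E.
Qed.

Definition subs (u0 u1 u2 : R3) : {rmorphism R3 -> R3} :=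
  sub3 (scal3 : {rmorphism K -> R3}) u0 u1 u2.

Lemma subsC u0 u1 u2 c : subs u0 u1 u2 (scal3 c) = scal3 c.
Proof. exact: sub3C. Qed.

Lemma subsx0 u0 u1 u2 : subs u0 u1 u2 x0 = u0.
Proof. exact: sub3x0. Qed.

Lemma subsx1 u0 u1 u2 : subs u0 u1 u2 x1 = u1.
Proof. exact: sub3x1. Qed.

Lemma subsx2 u0 u1 u2 : subs u0 u1 u2 x2 = u2.
Proof. exact: sub3x2. Qed.

Definition subsE := (subsC, subsx0, subsx1, subsx2).

Lemma subs_id (F : R3) : subs x0 x1 x2 F = F.
Proof. by apply: (rmorph3_eq (g := idfun)) => [c|||] /=; rewrite subsE. Qed.

Lemma rmorph_subs (T : comNzRingType) (chi : {rmorphism R3 -> T})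
    (psi : {rmorphism K -> T}) u0 u1 u2 F : (forall c, chi (scal3 c) = psi c) ->
  chi (subs u0 u1 u2 F) = sub3 psi (chi u0) (chi u1) (chi u2) F.
Proof. by move=> e; apply: sub3_comp. Qed.

Lemma subs_subs v0 v1 v2 u0 u1 u2 F :
  subs v0 v1 v2 (subs u0 u1 u2 F) =
  subs (subs v0 v1 v2 u0) (subs v0 v1 v2 u1) (subs v0 v1 v2 u2) F.
Proof. by apply: rmorph_subs => c; rewrite subsC. Qed.

Lemma coef3P (F G : R3) : (forall a b c, coef3 F a b c = coef3 G a b c) <-> F = G.
Proof.
split=> [e|-> //]; apply/polyP => c; apply/polyP => b; apply/polyP => a.
exact: e.
Qed.

Lemma coef3D (F G : R3) a b c : coef3 (F + G) a b c = coef3 F a b c + coef3 G a b c.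
Proof. by rewrite /coef3 !coefD. Qed.

Lemma coef3_0 a b c : coef3 (0 : R3) a b c = 0.
Proof. by rewrite /coef3 !coef0. Qed.

Lemma coef3Z k (F : R3) a b c : coef3 (scal3 k * F) a b c = k * coef3 F a b c.
Proof. by rewrite /coef3 /Defs.scal3 !coefCM. Qed.

Lemma coef3_sum (I : Type) (r : seq I) (P : pred I) (F : I -> R3) a b c :
  coef3 (\sum_(i <- r | P i) F i) a b c = \sum_(i <- r | P i) coef3 (F i) a b c.
Proof.
elim/big_rec2: _ => [|i y1 y2 _ <-]; first exact: coef3_0.
exact: coef3D.
Qed.

Lemma coef3_mono a b c i j k :
  coef3 (x0 ^+ a * x1 ^+ b * x2 ^+ c) i j k =
  ((i == a) && (j == b) && (k == c))%:R :> K.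
Proof.
rewrite /coef3 /x0 /x1 /x2 -!polyC_exp -polyCM coefCM coefXn.
case: (k == c); last by rewrite andbF mulr0 !coef0.
rewrite mulr1 coefCM coefXn andbT.
case: (j == b); last by rewrite andbF mulr0 !coef0.
by rewrite mulr1 coefXn andbT.
Qed.

Lemma coef3M (F G : R3) a b c :
  coef3 (F * G) a b c =
  \sum_(k < c.+1) \sum_(j < b.+1) \sum_(i < a.+1)
    coef3 F i j k * coef3 G (a - i) (b - j) (c - k).
Proof.
rewrite /coef3 coefM !coef_sum; apply: eq_bigr => k _.
rewrite coefM coef_sum; apply: eq_bigr => j _.
by rewrite coefM.
Qed.

End Substitution.

(** * Spaces of forms *)

Section Forms.
Variable K : closedFieldType.
Notation R3 := (R3 K).
Notation triple := (triple K).
Notation scal3 := (@scal3 K).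
Notation x0 := (x0 K).
Notation x1 := (x1 K).
Notation x2 := (x2 K).

(* Homogeneous of degree b - 1: shifting by one makes the zero space b = 0 a
   regular member of the family. *)
Definition hform (b : nat) (F : R3) : Prop :=
  forall i j k, (i + j + k).+1 <> b -> coef3 F i j k = 0.

Lemma homog_form F d : homog F d <-> hform d.+1 F.
Proof.
split=> [h i j k ne|h i j k /eqP nz].
  by apply/eqP/negPn/negP => /h e; apply: ne; rewrite e.
by apply: NNPP => ne; apply: nz; apply: h => -[].
Qed.

Lemma formD b F G : hform b F -> hform b G -> hform b (F + G).
Proof. by move=> hF hG i j k ne; rewrite coef3D hF // hG // addr0. Qed.

Lemma form0 b : hform b 0.
Proof. by move=> i j k _; rewrite coef3_0. Qed.

Lemma formZ b c F : hform b F -> hform b (scal3 c * F).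
Proof. by move=> hF i j k ne; rewrite coef3Z hF // mulr0. Qed.

Lemma form_sum b (I : Type) (r : seq I) (P : pred I) (F : I -> R3) :
  (forall i, P i -> hform b (F i)) -> hform b (\sum_(i <- r | P i) F i).
Proof.
move=> h; elim/big_rec: _ => [|i F' Pi]; first exact: form0.
by apply: formD; apply: h.
Qed.

Lemma formM b c F G : hform b.+1 F -> hform c.+1 G -> hform (b + c).+1 (F * G).
Proof.
move=> hF hG i j k ne; rewrite coef3M.
apply: big1 => k' _; apply: big1 => j' _; apply: big1 => i' _.
have := ltn_ord i'; have := ltn_ord j'; have := ltn_ord k' => lk lj li.
case: (eqVneq (i' + j' + k')%N b) => [e|/eqP e]; last by rewrite hF ?mul0r //; lia.
by rewrite hG ?mulr0 //; lia.
Qed.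

Lemma form_mono a b c : hform (a + b + c).+1 (x0 ^+ a * x1 ^+ b * x2 ^+ c).
Proof.
move=> i j k ne; rewrite coef3_mono.
case: andP => // -[/andP[/eqP ei /eqP ej] /eqP ek].
by case: ne; rewrite ei ej ek.
Qed.

Lemma form1 : hform 1 1.
Proof. by have := @form_mono 0%N 0%N 0%N; rewrite !expr0 !mulr1. Qed.

Lemma form_x0 : hform 2 x0.
Proof. by have := @form_mono 1%N 0%N 0%N; rewrite !expr0 !mulr1. Qed.

Lemma form_x1 : hform 2 x1.
Proof. by have := @form_mono 0%N 1%N 0%N; rewrite !expr0 mulr1 mul1r. Qed.

Lemma form_x2 : hform 2 x2.
Proof. by have := @form_mono 0%N 0%N 1%N; rewrite !expr0 !mul1r. Qed.

Lemma formX F n : hform 2 F -> hform n.+1 (F ^+ n).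
Proof.
move=> hF; elim: n => [|n IH]; first exact: form1.
by rewrite exprS; apply: (@formM 1 n).
Qed.

(** The pair (k, j) encodes the monomial x0^(b-1-k) x1^(k-j) x2^j of degree b - 1. Thus [nmon b] is
    the triangular number b(b+1)/2, which is also the number of conditions expected from a point of
    multiplicity b. *)
Definition mon (b : nat) := {k : 'I_b & 'I_k.+1}.
Definition nmon b := #|{: mon b}|.
Definition e0 b (t : mon b) : nat := (b.-1 - tag t)%N.
Definition e1 b (t : mon b) : nat := (tag t - tagged t)%N.
Definition e2 b (t : mon b) : nat := tagged t.

Lemma nmonE b : nmon b = (\sum_(k < b) k.+1)%N.
Proof.
rewrite /nmon card_tagged sumnE big_map big_enum /=.
by apply: eq_bigr => k _; rewrite card_ord.
Qed.

Lemma nmon0 : nmon 0 = 0%N. Proof. by rewrite nmonE big_ord0. Qed.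
Lemma nmonS b : nmon b.+1 = (nmon b + b.+1)%N.
Proof. by rewrite !nmonE big_ord_recr. Qed.

Lemma e_sum b (t : mon b) : (e0 t + e1 t + e2 t).+1 = b.
Proof.
case: t => k j; rewrite /e0 /e1 /e2 /=.
by have := ltn_ord k; have := ltn_ord j; lia.
Qed.

Lemma mon_of b i j k : (i + j + k).+1 = b ->
  exists t : mon b, [/\ e0 t = i, e1 t = j & e2 t = k].
Proof.
move=> e; have l1 : (j + k < b)%N by lia.
have l2 : (k < (Ordinal l1).+1)%N by rewrite /=; lia.
exists (Tagged (fun k : 'I_b => 'I_k.+1) (Ordinal l2)).
by rewrite /e0 /e1 /e2 /=; split; lia.
Qed.

Lemma e_inj b (t u : mon b) : e1 t = e1 u -> e2 t = e2 u -> t = u.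
Proof.
case: t u => k j [k' j']; rewrite /e1 /e2 /= => E1 E2.
have ek : k = k' by apply: val_inj => /=; have := ltn_ord j; have := ltn_ord j'; lia.
by subst k'; congr existT; apply: val_inj.
Qed.

Notation fv b := 'rV[K]_(nmon b).

Definition toP b (f : fv b) : R3 :=
  \sum_(t : mon b) scal3 (f 0 (enum_rank t)) * (x0 ^+ e0 t * x1 ^+ e1 t * x2 ^+ e2 t).
Definition ofP b (F : R3) : fv b :=
  \row_l coef3 F (e0 (enum_val l)) (e1 (enum_val l)) (e2 (enum_val l)).

Lemma coef3_toP b (f : fv b) (u : mon b) :
  coef3 (toP f) (e0 u) (e1 u) (e2 u) = f 0 (enum_rank u).
Proof.
rewrite coef3_sum (bigD1 u) //= coef3Z coef3_mono !eqxx mulr1.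
rewrite big1 ?addr0 // => t ne; rewrite coef3Z coef3_mono.
case: andP => [[/andP[_ /eqP E1] /eqP E2]|]; last by rewrite mulr0.
by case/eqP: ne; apply: e_inj.
Qed.

Lemma form_toP b (f : fv b) : hform b (toP f).
Proof.
move=> i j k ne; rewrite coef3_sum big1 // => t _.
rewrite coef3Z coef3_mono; case: andP => [[/andP[/eqP ei /eqP ej] /eqP ek]|]; last by rewrite mulr0.
by case: ne; rewrite ei ej ek; apply: e_sum.
Qed.

Lemma toPK b (f : fv b) : ofP b (toP f) = f.
Proof. by apply/rowP => l; rewrite mxE coef3_toP enum_valK. Qed.

Lemma ofPK b F : hform b F -> toP (ofP b F) = F.
Proof.
move=> hF; apply/coef3P => i j k.
case: (eqVneq (i + j + k).+1 b) => [/mon_of[t [<- <- <-]]|/eqP ne].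
  by rewrite coef3_toP mxE enum_rankK.
by rewrite hF // form_toP.
Qed.

Lemma toP_inj b : injective (@toP b).
Proof. exact: can_inj (@toPK b). Qed.

Lemma toPD b (f g : fv b) : toP (f + g) = toP f + toP g.
Proof.
by rewrite /toP -big_split /=; apply: eq_bigr => t _; rewrite mxE rmorphD /= mulrDl.
Qed.

Lemma toPZ b c (f : fv b) : toP (c *: f) = scal3 c * toP f.
Proof.
by rewrite /toP mulr_sumr; apply: eq_bigr => t _; rewrite mxE rmorphM /= -!mulrA.
Qed.

Lemma toP0 b : toP (0 : fv b) = 0.
Proof. by rewrite /toP big1 // => t _; rewrite mxE rmorph0 mul0r. Qed.

Lemma toP_linear b c (f g : fv b) : toP (c *: f + g) = scal3 c * toP f + toP g.
Proof. by rewrite toPD toPZ. Qed.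

Lemma toP_sum b (I : Type) (r : seq I) (P : pred I) (f : I -> fv b) :
  toP (\sum_(i <- r | P i) f i) = \sum_(i <- r | P i) toP (f i).
Proof. by elim/big_rec2: _ => [|i y1 y2 _ <-]; rewrite ?toP0 ?toPD. Qed.

Lemma ofP_linear b c F G : ofP b (scal3 c * F + G) = c *: ofP b F + ofP b G.
Proof. by apply/rowP => l; rewrite !mxE coef3D coef3Z. Qed.

Lemma form_expand b F : hform b F ->
  F = \sum_(t : mon b) scal3 (coef3 F (e0 t) (e1 t) (e2 t)) *
                       (x0 ^+ e0 t * x1 ^+ e1 t * x2 ^+ e2 t).
Proof.
move=> hF; rewrite -{1}(ofPK hF) /toP.
by apply: eq_bigr => t _; rewrite mxE enum_rankK.
Qed.

Lemma sub3_form b F (S : comNzRingType) (phi : {rmorphism K -> S}) u0 u1 u2 :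
  hform b F -> sub3 phi u0 u1 u2 F =
  \sum_(t : mon b) phi (coef3 F (e0 t) (e1 t) (e2 t)) *
                   (u0 ^+ e0 t * u1 ^+ e1 t * u2 ^+ e2 t).
Proof.
move=> hF; rewrite {1}(form_expand hF) rmorph_sum /=.
by apply: eq_bigr => t _; rewrite !rmorphM !rmorphXn /= !sub3E.
Qed.

Lemma subs_form b F u0 u1 u2 :
  hform b F -> subs u0 u1 u2 F =
  \sum_(t : mon b) scal3 (coef3 F (e0 t) (e1 t) (e2 t)) *
                   (u0 ^+ e0 t * u1 ^+ e1 t * u2 ^+ e2 t).
Proof. by move=> hF; apply: sub3_form. Qed.

Lemma form_subs b F u0 u1 u2 : hform 2 u0 -> hform 2 u1 -> hform 2 u2 ->
  hform b F -> hform b (subs u0 u1 u2 F).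
Proof.
move=> h0 h1 h2 hF; rewrite (subs_form _ _ _ hF); apply: form_sum => t _.
have h : hform (e0 t + e1 t + e2 t).+1 (u0 ^+ e0 t * u1 ^+ e1 t * u2 ^+ e2 t).
  by apply: formM; [apply: formM|]; apply: formX.
by rewrite e_sum in h; apply: formZ.
Qed.

Definition lin (l : triple) : R3 := scal3 l.1.1 * x0 + scal3 l.1.2 * x1 + scal3 l.2 * x2.

Lemma form_lin l : hform 2 (lin l).
Proof.
apply: formD; first apply: formD; apply: formZ.
- exact: form_x0. - exact: form_x1. - exact: form_x2.
Qed.

Definition dot (l p : triple) : K := l.1.1 * p.1.1 + l.1.2 * p.1.2 + l.2 * p.2.

Lemma sub3_lin (S : comNzRingType) (phi : {rmorphism K -> S}) u0 u1 u2 l :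
  sub3 phi u0 u1 u2 (lin l) = phi l.1.1 * u0 + phi l.1.2 * u1 + phi l.2 * u2.
Proof. by rewrite /lin !rmorphD !rmorphM /= !sub3E. Qed.

Lemma subs_lin u0 u1 u2 l :
  subs u0 u1 u2 (lin l) = scal3 l.1.1 * u0 + scal3 l.1.2 * u1 + scal3 l.2 * u2.
Proof. exact: sub3_lin. Qed.

Lemma eval3_lin l p : eval3 (lin l) p = dot l p.
Proof. by rewrite eval3E sub3_lin. Qed.

Lemma eval3_scale b F p c : hform b.+1 F ->
  eval3 F (c * p.1.1, c * p.1.2, c * p.2) = c ^+ b * eval3 F p.
Proof.
move=> hF; rewrite !eval3E !(sub3_form _ _ _ _ hF) mulr_sumr.
apply: eq_bigr => t _ /=; have [eb] := e_sum t.
by rewrite !exprMn -[b in c ^+ b]eb !exprD; ring.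
Qed.

End Forms.

(** * Powers of the ideal of a point *)

Section Ideals.
Variable K : closedFieldType.
Notation R3 := (R3 K).
Notation triple := (triple K).
Notation scal3 := (@scal3 K).
Notation x0 := (x0 K).
Notation x1 := (x1 K).
Notation x2 := (x2 K).

Lemma ring_lin3 (R : comPzRingType) (k1 k2 k3 a1 a2 a3 b1 b2 b3 c1 c2 c3 x y z : R) :
  k1 * (a1 * x + a2 * y + a3 * z) + k2 * (b1 * x + b2 * y + b3 * z) +
    k3 * (c1 * x + c2 * y + c3 * z) =
  (k1 * a1 + k2 * b1 + k3 * c1) * x + (k1 * a2 + k2 * b2 + k3 * c2) * y +
    (k1 * a3 + k2 * b3 + k3 * c3) * z.
Proof. by ring. Qed.

Lemma ring_taylor (R : comPzRingType) (l1 l2 l3 p1 p2 p3 u1 u2 u3 v1 v2 v3 x y z : R) :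
  l1 * (p1 + z * (u1 * x + v1 * y)) + l2 * (p2 + z * (u2 * x + v2 * y)) +
    l3 * (p3 + z * (u3 * x + v3 * y)) =
  l1 * p1 + l2 * p2 + l3 * p3 +
    ((l1 * u1 + l2 * u2 + l3 * u3) * x + (l1 * v1 + l2 * v2 + l3 * v3) * y) * z.
Proof. by ring. Qed.

Lemma ring_line (R : comPzRingType) (p u v x y z : R) :
  p * 1 + u * (z * x) + v * (z * y) = p + z * (u * x + v * y).
Proof. by ring. Qed.

Lemma inIdealP (S : R3 -> Prop) (F : R3) : inIdeal S F <->
  exists l : seq (R3 * R3), (forall x, x \in l -> S x.2) /\ F = \sum_(x <- l) x.1 * x.2.
Proof.
split=> [[gs [cs [sz [hS ->]]]]|[l [hS ->]]].
  exists (zip cs gs); split.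
    move=> x /(nthP (0, 0))[i]; rewrite size_zip sz minnn => lti <-.
    by rewrite nth_zip //=; apply: hS.
  rewrite (big_nth (0, 0)) size_zip sz minnn big_mkord.
  by apply: eq_bigr => i _; rewrite nth_zip.
exists (unzip2 l), (unzip1 l); rewrite !size_map; split=> //; split.
  move=> i lti; rewrite (nth_map (0, 0)) //; apply: hS; exact: mem_nth.
rewrite (big_nth (0, 0)) big_mkord.
by apply: eq_bigr => i _; rewrite !(nth_map (0, 0)).
Qed.

Lemma inIdeal0 (S : R3 -> Prop) : inIdeal S 0.
Proof. by apply/inIdealP; exists [::]; split=> //; rewrite big_nil. Qed.

Lemma inIdealD (S : R3 -> Prop) F G : inIdeal S F -> inIdeal S G -> inIdeal S (F + G).
Proof.
move=> /inIdealP[l [hl ->]] /inIdealP[k [hk ->]]; apply/inIdealP.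
exists (l ++ k); split; last by rewrite big_cat.
by move=> x; rewrite mem_cat => /orP[/hl|/hk].
Qed.

Lemma inIdeal_sum (S : R3 -> Prop) (I : Type) (r : seq I) (P : pred I) (F : I -> R3) :
  (forall i, P i -> inIdeal S (F i)) -> inIdeal S (\sum_(i <- r | P i) F i).
Proof.
move=> h; elim/big_rec: _ => [|i G Pi]; first exact: inIdeal0.
by apply: inIdealD; apply: h.
Qed.

Lemma inIdealM (S : R3 -> Prop) c F : inIdeal S F -> inIdeal S (c * F).
Proof.
move=> /inIdealP[l [hl ->]]; apply/inIdealP.
exists [seq (c * x.1, x.2) | x <- l]; split; first by move=> x /mapP[y /hl hy ->].
by rewrite big_map mulr_sumr; apply: eq_bigr => x _; rewrite mulrA.
Qed.

Lemma inIdeal_gen (S : R3 -> Prop) G : S G -> inIdeal S G.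
Proof.
move=> hG; apply/inIdealP; exists [:: (1, G)]; split; last by rewrite big_seq1 mul1r.
by move=> x; rewrite inE => /eqP->.
Qed.

Lemma inIdeal_mul (S S' : R3 -> Prop) G F :
  (forall H, S H -> S' (G * H)) -> inIdeal S F -> inIdeal S' (G * F).
Proof.
move=> h /inIdealP[l [hl ->]]; apply/inIdealP.
exists [seq (x.1, G * x.2) | x <- l]; split; first by move=> x /mapP[y /hl hy ->]; apply: h.
by rewrite big_map mulr_sumr; apply: eq_bigr => x _ /=; rewrite mulrCA.
Qed.

Lemma genIPm0 (p : triple) : genIPm p 0 1.
Proof. by exists [::]; split=> //; split=> //; rewrite big_nil. Qed.

Lemma genIPmS (p : triple) m G F : genIP p G -> genIPm p m F -> genIPm p m.+1 (G * F).
Proof.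
move=> hG [gs [sz [hgs ->]]]; exists (G :: gs); rewrite /= sz; split=> //.
by split; [case=> //= i; apply: hgs | rewrite big_cons].
Qed.

Lemma inIdeal_m0 (p : triple) F : inIdeal (genIPm p 0) F.
Proof. by rewrite -[F]mulr1; apply/inIdealM/inIdeal_gen/genIPm0. Qed.

Lemma inIdealS (p : triple) m G F :
  genIP p G -> inIdeal (genIPm p m) F -> inIdeal (genIPm p m.+1) (G * F).
Proof. by move=> hG; apply: inIdeal_mul => H; apply: genIPmS. Qed.

Lemma genIP_lin (p l : triple) : dot l p = 0 -> genIP p (lin l).
Proof.
by move=> e; exists 1%N; split; [apply/homog_form/form_lin | rewrite eval3_lin].
Qed.

Lemma inIdeal_lin2 (p l l' : triple) m i j F : dot l p = 0 -> dot l' p = 0 ->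
  (m <= i + j)%N -> inIdeal (genIPm p m) (F * (lin l ^+ i * lin l' ^+ j)).
Proof.
move=> hl hl'; elim: i m F => [|i IH] m F.
  rewrite expr0 mul1r; elim: j m F => [|j IH] [|m] F // lem; try exact: inIdeal_m0.
  rewrite exprS mulrCA; apply: inIdealS; [exact: genIP_lin | exact: IH].
case: m => [|m] lem; first exact: inIdeal_m0.
rewrite exprS -mulrA mulrCA; apply: inIdealS; [exact: genIP_lin | exact: IH].
Qed.

(** Each generator of the m-th power is a product of m elements, and each of them contributes one
    factor [e]. It is applied with [e] the parameter along the generic line through p, and with [e]
    a linear factor on a fixed line. *)
Lemma inIdeal_rmorph (p : triple) (S : comNzRingType) (chi : {rmorphism R3 -> S}) (e : S) m F :
  (forall g, genIP p g -> exists h, chi g = e * h) ->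
  inIdeal (genIPm p m) F -> exists h, chi F = e ^+ m * h.
Proof.
move=> hg /inIdealP[l [hl ->]]; elim: l hl => [|x l IH] hl.
  by exists 0; rewrite big_nil rmorph0 mulr0.
have [h eh] := IH (fun y yl => hl y (mem_behead (s := x :: l) yl)).
have [h' eh'] : exists h', chi x.2 = e ^+ m * h'.
  have [gs [<- [hgs ->]]] := hl x (mem_head _ _).
  elim: gs hgs {h eh IH hl} => [|g gs IH] hgs; first by exists 1; rewrite big_nil rmorph1 expr0 mulr1.
  have [h eh] := hg g (hgs 0%N isT); have [h' eh'] := IH (fun i lti => hgs i.+1 lti).
  by exists (h * h'); rewrite big_cons rmorphM eh eh' /= exprS mulrACA.
by exists (chi x.1 * h' + h); rewrite big_cons rmorphD rmorphM eh eh' /= mulrDr mulrCA.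
Qed.

(* (A, B, C) is a basis of K^3 and (a, b, c) its dual basis. *)
Record frame (A B C a b c : triple) : Prop := Frame {
  frA : [/\ dot a A = 1, dot b A = 0 & dot c A = 0];
  frB : [/\ dot a B = 0, dot b B = 1 & dot c B = 0];
  frC : [/\ dot a C = 0, dot b C = 0 & dot c C = 1];
  fr0 : forall p, p.1.1 = dot a p * A.1.1 + dot b p * B.1.1 + dot c p * C.1.1;
  fr1 : forall p, p.1.2 = dot a p * A.1.2 + dot b p * B.1.2 + dot c p * C.1.2;
  fr2 : forall p, p.2 = dot a p * A.2 + dot b p * B.2 + dot c p * C.2 }.

Lemma tnz_cases (p : triple) : tnz p -> [\/ p.1.1 != 0, p.1.2 != 0 | p.2 != 0].
Proof.
case: p => [[a b] c]; rewrite /tnz /= => h.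
case: (eqVneq a 0) => [a0|]; last by constructor 1.
case: (eqVneq b 0) => [b0|]; last by constructor 2.
by constructor 3; apply: contra h => /eqP ->; rewrite a0 b0.
Qed.

Lemma frame_point (P : triple) : tnz P ->
  exists U V a b c : triple, frame P U V a b c.
Proof.
case: P => [[x y] z] /tnz_cases[] /= nz.
(* [P] replaces the standard vector at one of its nonzero coordinates; the dual basis is read off
   the inverse matrix. *)
- exists (0,1,0), (0,0,1), (x^-1,0,0), (-y/x,1,0), (-z/x,0,1).
  by split; rewrite /dot /=; try split; try move=> [[p q] r] /=; field.
- exists (1,0,0), (0,0,1), (0,y^-1,0), (1,-x/y,0), (0,-z/y,1).
  by split; rewrite /dot /=; try split; try move=> [[p q] r] /=; field.
- exists (1,0,0), (0,1,0), (0,0,z^-1), (1,0,-x/z), (0,1,-y/z).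
  by split; rewrite /dot /=; try split; try move=> [[p q] r] /=; field.
Qed.

(** Dual to [frame_point]: [L] is completed to a basis of linear forms, so [A] and [B] span the
    line. *)
Lemma frame_line0 (L : triple) : tnz L ->
  exists A B C a b : triple, frame A B C a b L.
Proof.
case: L => [[x y] z] /tnz_cases[] /= nz.
- exists (-y/x,1,0), (-z/x,0,1), (x^-1,0,0), (0,1,0), (0,0,1).
  by split; rewrite /dot /=; try split; try move=> [[p q] r] /=; field.
- exists (1,-x/y,0), (0,-z/y,1), (0,y^-1,0), (1,0,0), (0,0,1).
  by split; rewrite /dot /=; try split; try move=> [[p q] r] /=; field.
- exists (1,0,-x/z), (0,1,-y/z), (0,0,z^-1), (1,0,0), (0,1,0).
  by split; rewrite /dot /=; try split; try move=> [[p q] r] /=; field.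
Qed.

Lemma avoid_seq (s : seq K) : exists c : K, c \notin s.
Proof.
have nz : \prod_(a <- s) ('X - a%:P) != 0 by rewrite monic_neq0 // monic_prod_XsubC.
by have /closed_nonrootP[c] := nz; rewrite root_prod_XsubC => hc; exists c.
Qed.

(** The shear [a - c b], [B + c A] preserves frames. Choosing [c] outside finitely many ratios is
    possible since K is infinite, and it keeps every point of X on L away from B, the point at
    infinity of the parametrization A + t B. *)
Lemma frame_line (L : triple) (X : seq triple) : tnz L -> (forall p, p \in X -> tnz p) ->
  exists A B C a b : triple, frame A B C a b L /\
    forall p, p \in X -> dot L p = 0 -> dot a p != 0.
Proof.
move=> /frame_line0[A [B [C [a [b h]]]]] hX.
have [c hc] := avoid_seq [seq dot a p / dot b p | p <- X].
exists A, (B.1.1 + c * A.1.1, B.1.2 + c * A.1.2, B.2 + c * A.2), C,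
  (a.1.1 - c * b.1.1, a.1.2 - c * b.1.2, a.2 - c * b.2), b.
have da p : dot (a.1.1 - c * b.1.1, a.1.2 - c * b.1.2, a.2 - c * b.2) p = dot a p - c * dot b p.
  by rewrite /dot /=; ring.
have dB l : dot l (B.1.1 + c * A.1.1, B.1.2 + c * A.1.2, B.2 + c * A.2) = dot l B + c * dot l A.
  by rewrite /dot /=; ring.
have [A1 A2 A3] := frA h; have [B1 B2 B3] := frB h; have [C1 C2 C3] := frC h.
split.
  split; rewrite ?da ?dB ?A1 ?A2 ?A3 ?B1 ?B2 ?B3 ?C1 ?C2 ?C3 /=;
    try by split; ring.
  - by move=> p; rewrite da {1}(fr0 h); ring.
  - by move=> p; rewrite da {1}(fr1 h); ring.
  - by move=> p; rewrite da {1}(fr2 h); ring.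
move=> p pX Lp; rewrite da; apply/negP => /eqP e.
case: (eqVneq (dot b p) 0) => [b0|bn].
  have a0 : dot a p = 0 by rewrite -e b0; ring.
  have := hX p pX; rewrite /tnz [p]surjective_pairing [p.1]surjective_pairing.
  by rewrite (fr0 h) (fr1 h) (fr2 h) a0 b0 Lp !mul0r !addr0 eqxx.
case/negP: hc; apply/mapP; exists p => //.
by apply: (mulIf bn); rewrite divfK //; apply/esym/eqP; rewrite -subr_eq0 e.
Qed.

(** The change of coordinates F(x0 A + x1 B + x2 C); [unhat] on the dual basis is its inverse. *)
Definition hat (A B C : triple) : {rmorphism R3 -> R3} :=
  subs (lin (A.1.1, B.1.1, C.1.1)) (lin (A.1.2, B.1.2, C.1.2)) (lin (A.2, B.2, C.2)).
Definition unhat (a b c : triple) : {rmorphism R3 -> R3} :=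
  subs (lin a) (lin b) (lin c).

Lemma ring_unit3 (R : comPzRingType) (x y z : R) :
  [/\ 1 * x + 0 * y + 0 * z = x, 0 * x + 1 * y + 0 * z = y & 0 * x + 0 * y + 1 * z = z].
Proof. by split; ring. Qed.

Lemma lin_unit : [/\ lin (1, 0, 0) = x0, lin (0, 1, 0) = x1 & lin (0, 0, 1) = x2].
Proof.
have [E0 E1 E2] := ring_unit3 x0 x1 x2.
by split; rewrite /lin; cbn [fst snd]; rewrite scal3_0 scal3_1.
Qed.

Lemma lin_eq (x y z x' y' z' : K) :
  x = x' -> y = y' -> z = z' -> lin (x, y, z) = lin (x', y', z').
Proof. by move=> -> -> ->. Qed.

Lemma unhat_lin (a b c k : triple) : unhat a b c (lin k) =
    lin (k.1.1 * a.1.1 + k.1.2 * b.1.1 + k.2 * c.1.1,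
         k.1.1 * a.1.2 + k.1.2 * b.1.2 + k.2 * c.1.2,
         k.1.1 * a.2 + k.1.2 * b.2 + k.2 * c.2).
Proof.
rewrite [LHS]subs_lin [RHS]/lin.
cbn [fst snd]; rewrite !scal3D !scal3M.
exact: ring_lin3.
Qed.

Lemma hatK (A B C a b c : triple) F : frame A B C a b c -> unhat a b c (hat A B C F) = F.
Proof.
move=> h; have E0 := fr0 h; have E1 := fr1 h; have E2 := fr2 h; rewrite /dot in E0 E1 E2.
(* The three coordinate identities of the frame, evaluated at the standard vectors, give the nine
   entries of a matrix identity. *)
have T (f g : triple -> K) : (forall p, f p = g p) ->
  [/\ g (1,0,0) = f (1,0,0), g (0,1,0) = f (0,1,0) & g (0,0,1) = f (0,0,1)].
  by move=> E; split.
have [p1 p2 p3] := T _ _ E0; have [q1 q2 q3] := T _ _ E1; have [r1 r2 r3] := T _ _ E2.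
have [u0 u1 u2] := lin_unit.
have U0 : unhat a b c (lin (A.1.1, B.1.1, C.1.1)) = x0.
  rewrite unhat_lin -u0; cbn [fst snd]; apply: lin_eq.
  - by rewrite -[RHS]p1; cbn [fst snd]; ring.
  - by rewrite -[RHS]p2; cbn [fst snd]; ring.
  - by rewrite -[RHS]p3; cbn [fst snd]; ring.
have U1 : unhat a b c (lin (A.1.2, B.1.2, C.1.2)) = x1.
  rewrite unhat_lin -u1; cbn [fst snd]; apply: lin_eq.
  - by rewrite -[RHS]q1; cbn [fst snd]; ring.
  - by rewrite -[RHS]q2; cbn [fst snd]; ring.
  - by rewrite -[RHS]q3; cbn [fst snd]; ring.
have U2 : unhat a b c (lin (A.2, B.2, C.2)) = x2.
  rewrite unhat_lin -u2; cbn [fst snd]; apply: lin_eq.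
  - by rewrite -[RHS]r1; cbn [fst snd]; ring.
  - by rewrite -[RHS]r2; cbn [fst snd]; ring.
  - by rewrite -[RHS]r3; cbn [fst snd]; ring.
rewrite /hat [LHS]subs_subs -/(unhat a b c).
by rewrite U0 U1 U2 subs_id.
Qed.

Lemma form_hat A B C b F : hform b F -> hform b (hat A B C F).
Proof. by apply: form_subs; apply: form_lin. Qed.

Lemma form_unhat A B C b F : hform b F -> hform b (unhat A B C F).
Proof. by apply: form_subs; apply: form_lin. Qed.

Lemma coef0_factor (R : nzRingType) (F : {poly R}) : F`_0 = 0 -> exists H, F = H * 'X.
Proof.
move=> e; have /factor_theorem[H ->] : root F 0 by rewrite /root horner_coef0 e.
by exists H; rewrite polyC0 subr0.
Qed.

(** In coordinates with P as first basis vector, every surviving monomial has degree at least m in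
    x1 and x2, and these become the forms [b] and [c], which vanish at P. *)
Lemma hat_inIdeal (P U V a b c : triple) B F m : frame P U V a b c -> hform B F ->
  (forall i j k, (j + k < m)%N -> coef3 (hat P U V F) i j k = 0) ->
  inIdeal (genIPm P m) F.
Proof.
move=> h hF hc; rewrite -(hatK F h) /unhat (subs_form _ _ _ (form_hat P U V hF)).
apply: inIdeal_sum => t _; case: (ltnP (e1 t + e2 t) m) => [/hc->|le].
  by rewrite rmorph0 mul0r; apply: inIdeal0.
have [_ b0 c0] := frA h.
by rewrite -mulrA mulrA; apply: inIdeal_lin2.
Qed.

(* The generic line P + T (x0 U + x1 V) through P; the outer variable
   of R3 plays the role of T. *)
Definition taylor (P U V : triple) : {rmorphism R3 -> R3} :=
  subs (scal3 P.1.1 + x2 * (scal3 U.1.1 * x0 + scal3 V.1.1 * x1))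
             (scal3 P.1.2 + x2 * (scal3 U.1.2 * x0 + scal3 V.1.2 * x1))
             (scal3 P.2 + x2 * (scal3 U.2 * x0 + scal3 V.2 * x1)).

Lemma taylor_coef0 (P U V : triple) F : (taylor P U V F)`_0 = (eval3 F P)%:P%:P.
Proof.
rewrite -horner_coef0 eval3E.
pose f : {rmorphism R3 -> {poly {poly K}}} := horner_eval 0 \o taylor P U V.
pose g : {rmorphism R3 -> {poly {poly K}}} :=
  polyC \o (polyC \o sub3 idfun P.1.1 P.1.2 P.2).
have E (u v w : K) : (scal3 u + x2 * (scal3 v * x0 + scal3 w * x1)).[0] = u%:P%:P.
  by rewrite hornerD hornerM hornerX mul0r addr0 hornerC.
apply: (rmorph3_eq (f := f) (g := g)); rewrite /f /g /= /horner_eval.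
- by move=> c; rewrite subsC sub3C hornerC.
- by rewrite subsx0 sub3x0 E.
- by rewrite subsx1 sub3x1 E.
- by rewrite subsx2 sub3x2 E.
Qed.

(** A form vanishing at P has no constant term along the generic line, hence is divisible by T
    there; m such factors give T^m. With [taylor_inIdeal] this turns membership in the m-th power
    into a condition on coefficients. *)
Lemma inIdeal_taylor (P U V : triple) F m : inIdeal (genIPm P m) F ->
  forall k, (k < m)%N -> (taylor P U V F)`_k = 0.
Proof.
move=> hF; have [|H ->] := inIdeal_rmorph (chi := taylor P U V) (e := x2) _ hF; last first.
  by move=> k lk; rewrite coefXnM lk.
move=> g [d [_ g0]]; have [|H ->] := @coef0_factor _ (taylor P U V g).
  by rewrite taylor_coef0 g0 !polyC0.
by exists H; rewrite mulrC.
Qed.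

(** The Taylor expansion is the form in adapted coordinates with x0, x1, x2 replaced by 1, T x0, T
    x1. As the degree is fixed, distinct monomials stay distinct, and x1^j x2^k lands in the
    coefficient of T^(j+k). *)
Lemma taylor_hat (P U V : triple) b F m : hform b F ->
  (forall k, (k < m)%N -> (taylor P U V F)`_k = 0) ->
  forall i j k, (j + k < m)%N -> coef3 (hat P U V F) i j k = 0.
Proof.
move=> hF h i j k lt.
case: (eqVneq (i + j + k).+1 b) => [/mon_of[u [<- ej ek]]|/eqP ne]; last first.
  by apply: (form_hat _ _ _ hF).
have -> : coef3 (hat P U V F) (e0 u) j k = coef3 (taylor P U V F) j k (j + k); last first.
  by rewrite /coef3 h // !coef0.
have -> : taylor P U V F = subs 1 (x2 * x0) (x2 * x1) (hat P U V F).
  rewrite /hat subs_subs !subs_lin /taylor.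
  by cbn [fst snd]; rewrite !ring_line.
rewrite (subs_form _ _ _ (form_hat P U V hF)) coef3_sum (bigD1 u) //=.
have M t : 1 ^+ e0 t * (x2 * x0) ^+ e1 t * (x2 * x1) ^+ e2 t =
   x0 ^+ e1 t * x1 ^+ e2 t * x2 ^+ (e1 t + e2 t) by rewrite expr1n mul1r !exprMn exprD mulrACA mulrC.
rewrite coef3Z M coef3_mono ej ek !eqxx mulr1 big1 ?addr0 // => t ne.
rewrite coef3Z M coef3_mono; case: andP => [[/andP[/eqP E1 /eqP E2] _]|]; last by rewrite mulr0.
by case/eqP: ne; apply: e_inj; rewrite ?ej ?ek.
Qed.

Lemma taylor_inIdeal (P U V a b c : triple) B F m : frame P U V a b c -> hform B F ->
  (forall k, (k < m)%N -> (taylor P U V F)`_k = 0) -> inIdeal (genIPm P m) F.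
Proof. by move=> h hF /(taylor_hat hF); apply: hat_inIdeal h hF. Qed.

End Ideals.

(** * Division by a linear form and restriction to a line *)

Section Ideals2.
Variable K : closedFieldType.
Notation R3 := (R3 K).
Notation triple := (triple K).
Notation scal3 := (@scal3 K).
Notation x0 := (x0 K).
Notation x1 := (x1 K).
Notation x2 := (x2 K).

Lemma bilin_eq0 (u v : K) :
  u%:P%:P * ('X%:P : {poly {poly K}}) + v%:P%:P * 'X = 0 -> u = 0 /\ v = 0.
Proof.
move=> e; split.
  have := congr1 (fun q : {poly {poly K}} => q`_0`_1) e.
  by rewrite coefD !coefCM coefC coefX /= mulr0 addr0 coefCM coefX mulr1 !coef0.
have := congr1 (fun q : {poly {poly K}} => q`_1`_0) e.
by rewrite coefD !coefCM coefC coefX /= mulr0 add0r mulr1 coefC !coef0.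
Qed.

(** Along the generic line through P the form of L becomes L(P) + w T. Comparing coefficients of T
    in the product recovers the vanishing order of G, which is one less than m exactly when L passes
    through P. *)
Lemma inIdeal_divl (P L : triple) b G m : tnz P -> tnz L -> hform b G ->
  inIdeal (genIPm P m) (lin L * G) -> inIdeal (genIPm P (m - onLine L P)) G.
Proof.
move=> /frame_point[U [V [a0 [b0 [c0 h]]]]] hL hG hI.
have hF := inIdeal_taylor U V hI.
apply: (taylor_inIdeal h hG).
pose w : {poly {poly K}} := (dot L U)%:P%:P * ('X%:P : {poly {poly K}}) + (dot L V)%:P%:P * 'X.
have eL : taylor P U V (lin L) = (dot L P)%:P%:P%:P + w%:P * 'X.
  rewrite /taylor subs_lin /w /dot /x0 /x1 /x2 /Defs.scal3 !(polyCD, polyCM).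
  exact: ring_taylor.
have hT k : (k < m)%N -> (((dot L P)%:P%:P%:P + w%:P * 'X) * taylor P U V G)`_k = 0.
  by move=> lk; rewrite -eL -rmorphM; apply: hF.
move: (taylor P U V G) hT => T hT.
have hF' k : (k < m)%N -> (dot L P)%:P%:P * T`_k + w * (if k is k'.+1 then T`_k' else 0) = 0.
  by move=> lk; have := hT k lk; rewrite mulrDl coefD coefCM -mulrA coefCM coefXM; case: k lk.
rewrite /onLine -/(dot L P); case: eqP => [e|/eqP ne] /=.
  (* Otherwise L would vanish on the whole basis P, U, V. *)
  have wn : w != 0.
    apply/negP => /eqP w0.
    have [wU wV] := bilin_eq0 w0.
    have E p : dot L p = 0.
      have -> : dot L p = dot a0 p * dot L P + dot b0 p * dot L U + dot c0 p * dot L V.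
        rewrite {1}/dot (fr0 h p) (fr1 h p) (fr2 h p) /dot; ring.
      by rewrite e wU wV !mulr0 !addr0.
    move: hL; rewrite /tnz [L]surjective_pairing [L.1]surjective_pairing.
    have := E (1,0,0); have := E (0,1,0); have := E (0,0,1).
    rewrite /dot /= !mulr0 !mulr1 !add0r !addr0 => -> -> ->.
    by rewrite eqxx.
  move=> k lk; have := hF' k.+1; rewrite e !polyC0 mul0r add0r => H.
  have /eqP := H ltac:(lia); rewrite mulf_eq0 (negPf wn) /= => /eqP //.
(* Off L the constant term L(P) is nonzero, so the coefficients of G vanish one after another. *)
rewrite subn0; elim/ltn_ind => k IH lk; have := hF' k lk.
have -> : (if k is k'.+1 then T`_k' else 0) = 0.
  by case: k IH lk => // k IH lk; apply: IH => //; apply: ltnW.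
by rewrite mulr0 addr0 => /eqP; rewrite mulf_eq0 !polyC_eq0 (negPf ne) => /eqP.
Qed.

Lemma inIdeal_mull (P L : triple) G m :
  inIdeal (genIPm P (m - onLine L P)) G -> inIdeal (genIPm P m) (lin L * G).
Proof.
rewrite /onLine -/(dot L P); case: eqP => [e|_]; last by rewrite subn0; apply: inIdealM.
by case: m => [|m]; rewrite ?subn1 => h; [apply: inIdeal_m0 | apply: inIdealS h; apply: genIP_lin].
Qed.

(** Restriction to the line AB, as a polynomial in the affine parameter t of A + t B. *)
Definition restr (A B : triple) : {rmorphism R3 -> {poly K}} :=
  sub3 polyC (A.1.1%:P + B.1.1%:P * 'X) (A.1.2%:P + B.1.2%:P * 'X) (A.2%:P + B.2%:P * 'X).

Lemma restr_hat (A B C : triple) F :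
  restr A B F = sub3 polyC 1 'X 0 (hat A B C F).
Proof.
rewrite /hat (rmorph_subs (psi := polyC)); last by move=> c; rewrite sub3C.
by rewrite !sub3_lin /restr /=; congr (sub3 _ _ _ _ F); rewrite mulr1 mulr0 addr0.
Qed.

Lemma coef_restr (A B C : triple) b F j : hform b F ->
  (restr A B F)`_j = if (j < b)%N then coef3 (hat A B C F) (b.-1 - j) j 0 else 0.
Proof.
move=> hF; rewrite (restr_hat A B C) (sub3_form _ _ _ _ (form_hat A B C hF)) coef_sum.
have M (t : mon b) k : (k%:P * (1 ^+ e0 t * 'X ^+ e1 t * 0 ^+ e2 t) : {poly K})`_j =
    k * ((j == e1 t) && (e2 t == 0%N))%:R.
  rewrite coefCM expr1n mul1r expr0n; case: (e2 t == 0%N); last by rewrite mulr0 coef0 andbF.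
  by rewrite mulr1 coefXn andbT.
case: ltnP => lj.
  have [u [<- eu1 eu2]] : exists t : mon b, [/\ e0 t = (b.-1 - j)%N, e1 t = j & e2 t = 0%N].
    by apply: mon_of; lia.
  rewrite (bigD1 u) //= M eu1 eu2 !eqxx mulr1 big1 ?addr0 // => t ne.
  rewrite M; case: andP => [[/eqP E1 /eqP E2]|]; last by rewrite mulr0.
  by case/eqP: ne; apply: e_inj; rewrite ?eu1 ?eu2.
apply: big1 => t _; rewrite M; have := e_sum t.
by case: eqP => [e|]; [lia | rewrite mulr0].
Qed.

Lemma size_restr (A B : triple) b F : hform b F -> (size (restr A B F) <= b)%N.
Proof.
by move=> hF; apply/leq_sizeP => j lj; rewrite (coef_restr A B A j hF) ltnNge lj.
Qed.

Lemma restr_eval (A B : triple) F t : (restr A B F).[t] =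
  eval3 F (A.1.1 + B.1.1 * t, A.1.2 + B.1.2 * t, A.2 + B.2 * t).
Proof.
rewrite eval3E; cbn [fst snd].
pose f : {rmorphism R3 -> K} := horner_eval t \o restr A B.
apply: (rmorph3_eq (f := f)); rewrite /f /= /horner_eval.
- by move=> c; rewrite !sub3C hornerC.
- by rewrite !sub3x0 !hornerE.
- by rewrite !sub3x1 !hornerE.
- by rewrite !sub3x2 !hornerE.
Qed.

(** Up to a nonzero scalar, p is A + tau B with tau = b(p)/a(p); forms vanishing at p therefore
    restrict to polynomials with root tau. *)
Lemma restr_dvd (A B C a b L p : triple) m F : frame A B C a b L ->
  dot L p = 0 -> dot a p != 0 -> inIdeal (genIPm p m) F ->
  (('X - (dot b p / dot a p)%:P) ^+ m %| restr A B F)%R.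
Proof.
move=> h Lp an; set tau := _ / _.
move=> hF; have [|H ->] := inIdeal_rmorph (chi := restr A B) (e := 'X - tau%:P) _ hF; last first.
  by apply: dvdp_mulr.
move=> g [d [/homog_form hg g0]].
suff /dvdpP[H ->] : ('X - tau%:P %| restr A B g)%R by exists H; rewrite mulrC.
rewrite dvdp_XsubCl /root.
rewrite restr_eval.
have : eval3 g p = dot a p ^+ d * eval3 g (A.1.1 + B.1.1 * tau, A.1.2 + B.1.2 * tau, A.2 + B.2 * tau).
  rewrite -(eval3_scale _ _ hg) /=; congr eval3.
  rewrite [p in LHS]surjective_pairing [p.1 in LHS]surjective_pairing.
  rewrite [p.1.1](fr0 h) [p.1.2](fr1 h) [p.2](fr2 h) Lp /tau.
  by congr (_, _, _); field.
rewrite g0 => /esym/eqP; rewrite mulf_eq0 expf_eq0 (negPf an) andbF /=.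
by [].
Qed.

(** In coordinates adapted to L, restriction sets x2 = 0. A form with zero restriction is a multiple
    of x2, and x2 is carried back to [lin L]. *)
Lemma restr_eq0 (A B C a b L : triple) B' F : frame A B C a b L -> hform B'.+1 F ->
  restr A B F = 0 -> exists2 G, hform B' G & F = lin L * G.
Proof.
move=> h hF r0.
have [G eG] : exists H, hat A B C F = H * 'X.
  apply: coef0_factor; apply/polyP => j; apply/polyP => i; rewrite !coef0.
  case: (eqVneq (i + j + 0).+1 B'.+1) => [e|/eqP ne]; last by apply: (form_hat A B C hF).
  have := coef_restr A B C j hF; rewrite r0 coef0 /= ifT; last lia.
  by have -> : (B' - j)%N = i by lia.
exists (unhat a b L G); last first.
  by rewrite -(hatK F h) eG rmorphM [X in _ * X]subsx2 mulrC.
apply: form_unhat => i j k ne.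
have := form_hat A B C hF (i := i) (j := j) (k := k.+1); rewrite eG /coef3 coefMX /=.
by apply; lia.
Qed.

End Ideals2.

(** * Dimensions *)

Section LinearAlgebra.
Variable K : fieldType.

Lemma lin_hom (aT rT : vectType K) (g : aT -> rT) :
  linear g -> exists h : 'Hom(aT, rT), forall v, h v = g v.
Proof.
move=> gl.
pose gL : {linear aT -> rT} := HB.pack g (GRing.isLinear.Build K aT rT *:%R g gl).
by exists (linfun gL) => v; rewrite lfunE.
Qed.

(** A subspace contained in P is enlarged by one vector at a time; the ambient dimension bounds the
    number of enlargements. *)
Lemma vspace_of_pred (vT : vectType K) (P : vT -> Prop) :
  P 0 -> (forall c u v, P u -> P v -> P (c *: u + v)) ->
  exists U : {vspace vT}, forall v, v \in U <-> P v.
Proof.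
move=> P0 Pl.
have main n (U : {vspace vT}) : (forall v, v \in U -> P v) ->
    (\dim {:vT} <= \dim U + n)%N -> exists U : {vspace vT}, forall v, v \in U <-> P v.
  elim: n U => [|n IH] U hU le.
    have eU : U = fullv by apply/eqP; rewrite eqEdim subvf -[\dim U]addn0.
    exists U => v; split; first exact: hU.
    by rewrite eU memvf.
  have [[v [Pv vU]]|no] := classic (exists v, P v /\ v \notin U).
    apply: (IH (U + <[v]>)%VS).
      by move=> w /memv_addP[u uU [_ /vlineP[c ->] ->]]; rewrite addrC; apply: Pl => //; apply: hU.
    suff : (\dim U < \dim (U + <[v]>))%N by lia.
    rewrite ltn_neqAle dimvS ?addvSl // andbT; apply/negP => /eqP e.
    have /eqP eU : U == (U + <[v]>)%VS by rewrite eqEdim addvSl e /=.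
    have : v \in (U + <[v]>)%VS by apply: (subvP (addvSr U _)); apply: memv_line.
    by rewrite -eU (negPf vU).
  exists U => v; split; first exact: hU.
  by move=> Pv; apply: NNPP => vU; apply: no; exists v; split=> //; apply/negP.
apply: (main (\dim {:vT}) 0%VS); last by rewrite leq_addl.
by move=> v; rewrite memv0 => /eqP->.
Qed.

Lemma cut_functionals (vT : vectType K) (U : {vspace vT}) (I : finType) (phi : I -> vT -> K) :
  (forall i c u v, phi i (c *: u + v) = c * phi i u + phi i v) ->
  exists W : {vspace vT}, (forall v, v \in W <-> (v \in U /\ forall i, phi i v = 0)) /\
    (\dim U <= \dim W + #|I|)%N.
Proof.
move=> hl.
have [h hE] : exists h : 'Hom(vT, 'rV[K]_#|I|), forall v, h v = \row_k phi (enum_val k) v.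
  by apply: lin_hom => c u v; apply/rowP => k; rewrite !mxE hl.
exists (U :&: lker h)%VS; split.
  move=> v; rewrite memv_cap memv_ker hE; split.
    case/andP=> vU /eqP e; split=> // i; have := congr1 (fun r : 'rV_ _ => r 0 (enum_rank i)) e.
    by rewrite !mxE enum_rankK.
  by case=> -> e /=; apply/eqP/rowP => k; rewrite !mxE e.
rewrite -(limg_ker_dim h U) leq_add2l.
by apply: leq_trans (dimvS (subvf _)) _; rewrite dimvf /dim /= mul1n.
Qed.

End LinearAlgebra.

(** * Dimensions of spaces of forms with prescribed multiplicities *)

Section Dimensions.
Variable K : closedFieldType.
Notation R3 := (R3 K).
Notation triple := (triple K).
Notation scal3 := (@scal3 K).
Notation fv b := 'rV[K]_(nmon b).

Lemma nmon_sqr b : (nmon b <= b * b)%N.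
Proof. by elim: b => [|b IH]; [rewrite nmon0 | rewrite nmonS; lia]. Qed.

Lemma dim_fv b : \dim {: fv b} = nmon b.
Proof. by rewrite dimvf /dim /= mul1n. Qed.

Lemma linindepP b (gs : seq (fv b)) :
  linindep (map (@toP K b) gs) <-> free gs.
Proof.
have E (cs : seq K) : \sum_(i < size gs) scal3 cs`_i * (map (@toP K b) gs)`_i =
    toP (\sum_(i < size gs) cs`_i *: gs`_i).
  rewrite toP_sum; apply: eq_bigr => i _.
  by rewrite toPZ (nth_map 0).
split=> [h|/(@freeP _ _ _ (in_tuple gs)) h cs].
  apply/(@freeP _ _ _ (in_tuple gs)) => k e i.
  pose cs := [tuple k j | j < size gs].
  have csE (j : 'I_(size gs)) : cs`_j = k j by rewrite -tnth_nth tnth_mktuple.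
  rewrite -csE; apply: (h cs); [by rewrite size_tuple size_map | | by rewrite size_map].
  rewrite size_map E (_ : \sum_(i < _) _ = 0) ?toP0 // -[RHS]e.
  by apply: eq_bigr => j _; rewrite csE.
rewrite size_map => sz; rewrite E => e i li.
have e' : \sum_(i < size gs) cs`_i *: (in_tuple gs)`_i = 0 by apply: toP_inj; rewrite toP0.
exact: (h (fun i => cs`_i) e' (Ordinal li)).
Qed.

Lemma dimdegE t (Q : R3 -> Prop) (U : {vspace fv t.+1}) :
  (forall F, Q F -> hform t.+1 F) -> (forall f, f \in U <-> Q (toP f)) ->
  dimdeg t Q = \dim U.
Proof.
move=> hQ hU; apply/eqP; rewrite eqn_leq; apply/andP; split.
  apply/bigmax_leqP => n; rewrite /decideP; case: excluded_middle_informative => // -[fs [sz [hfs hl]]] _.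
  pose gs := map (ofP t.+1) fs.
  have e : fs = map (@toP K t.+1) gs.
    rewrite -map_comp; apply: (@eq_from_nth _ 0); rewrite ?size_map // => i li.
    by rewrite (nth_map 0) //= ofPK //; apply/hQ/hfs; rewrite -sz.
  rewrite e linindepP in hl; rewrite -sz -(size_map (ofP t.+1) fs) -/gs.
  rewrite -(eqP hl); apply: dimvS; apply/span_subvP => g /(nthP 0)[i].
  rewrite size_map => li <-; apply/hU; rewrite (nth_map 0) //.
  by rewrite ofPK; [apply: hfs; rewrite -sz | apply/hQ/hfs; rewrite -sz].
(* The bound [nmon b <= b * b] puts the dimension inside the index range of the maximum in
   [dimdeg]. *)
have lt : (\dim U < ((t + 2) ^ 2).+1)%N.
  rewrite ltnS (leq_trans (dimvS (subvf U))) // dim_fv (leq_trans (nmon_sqr _)) //.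
  by rewrite expnS expn1; lia.
rewrite /dimdeg; apply: (@leq_bigmax_cond _ _ (fun n : 'I_((t + 2) ^ 2).+1 => val n) (Ordinal lt)).
rewrite /decideP; case: excluded_middle_informative => // -[].
exists (map (@toP K t.+1) (vbasis U)); rewrite size_map size_tuple; split=> //; split.
  move=> i li; rewrite (nth_map 0) ?size_tuple //; apply/hU/vbasis_mem/mem_nth.
  by rewrite size_tuple.
by apply/linindepP; apply: basis_free (vbasisP U).
Qed.

Definition inX (X : seq triple) (mu : triple -> nat) (F : R3) : Prop :=
  forall p, p \in X -> inIdeal (genIPm p (mu p)) F.

Lemma exists_fat X mu b :
  exists U : {vspace fv b}, forall f, f \in U <-> inX X mu (toP f).
Proof.
apply: vspace_of_pred => [p _|c u v hu hv p pX].
  by rewrite toP0; apply: inIdeal0.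
by rewrite toP_linear; apply: inIdealD; [apply/inIdealM/hu | apply: hv].
Qed.

Definition fat X mu b : {vspace fv b} :=
  proj1_sig (constructive_indefinite_description _ (exists_fat X mu b)).

Lemma fatP X mu b f : f \in fat X mu b <-> inX X mu (toP f).
Proof. exact: (proj2_sig (constructive_indefinite_description _ (exists_fat X mu b))). Qed.

(** The dimension d(mu, b); multiplicities vary from point to point because lines are removed one at
    a time. *)
Definition fdim X mu b : nat := \dim (fat X mu b).

Lemma hatZ A B C c F G :
  hat A B C (scal3 c * F + G) = scal3 c * hat A B C F + hat A B C G.
Proof. by rewrite [LHS]rmorphD [X in X + _]rmorphM /hat subsC. Qed.

Lemma restrZ A B c F G :
  restr A B (scal3 c * F + G) = c *: restr A B F + restr A B G.
Proof.
have e : restr A B (scal3 c) = c%:P by exact: sub3C.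
by rewrite [LHS]rmorphD [X in X + _]rmorphM e -mul_polyC.
Qed.

(** Each point P imposes at most [nmon (mu P)] linear conditions: the vanishing of the coefficients
    of degree below mu P in x1 and x2, in coordinates adapted to P. *)
Lemma fat_low X mu b : (forall p, p \in X -> tnz p) ->
  (nmon b <= fdim X mu b + \sum_(p <- X) nmon (mu p))%N.
Proof.
rewrite /fdim; elim: X => [|P X IH] hX.
  rewrite big_nil addn0; apply: leq_trans (dimvS (_ : fullv <= _)%VS).
    by rewrite dim_fv.
  by apply/subvP => f _; apply/fatP.
have {}IH := IH (fun p pX => hX p (mem_behead (s := P :: X) pX)).
have [U [V [a [d [c h]]]]] := frame_point (hX P (mem_head _ _)).
(* The exponent of x0 is forced by the degree. If the subtraction truncates, the coefficient lies
   outside degree b - 1 and the condition is vacuous. *)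
pose phi (t : mon (mu P)) (f : fv b) := coef3 (hat P U V (toP f)) (b.-1 - (e1 t + e2 t)) (e1 t) (e2 t).
have [|W [hW dW]] := @cut_functionals K _ (fat X mu b) _ phi.
  by move=> t k u v; rewrite /phi toP_linear hatZ coef3D coef3Z.
rewrite big_cons addnCA addnA addnC.
have : (\dim W <= \dim (fat (P :: X) mu b))%N.
  apply: dimvS; apply/subvP => f /hW[/fatP fX f0]; apply/fatP => p.
  rewrite inE => /orP[/eqP->|]; last exact: fX.
  apply: (hat_inIdeal h (form_toP f)) => i j k lt.
  case: (eqVneq (i + j + k).+1 b) => [e|/eqP ne]; last exact: (form_hat P U V (form_toP f)).
  have [t [_ t1 t2]] : exists t : mon (mu P), [/\ e0 t = ((mu P).-1 - (j + k))%N, e1 t = j & e2 t = k].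
    by apply: mon_of; lia.
  have ei : (b.-1 - (j + k))%N = i by lia.
  by have := f0 t; rewrite /phi t1 t2 ei.
by rewrite -/(nmon (mu P)) in dW; lia.
Qed.

Lemma prod_dvd (l : seq triple) (tau : triple -> K) (mu : triple -> nat) (F : {poly K}) :
  uniq (map tau l) -> (forall p, p \in l -> (('X - (tau p)%:P) ^+ mu p %| F)%R) ->
  (\prod_(p <- l) ('X - (tau p)%:P) ^+ mu p %| F)%R.
Proof.
elim: l => [|p l IH] /=; first by rewrite big_nil dvd1p.
case/andP=> np ul h; rewrite big_cons Gauss_dvdp.
  by rewrite h ?mem_head //=; apply: IH => // q ql; apply: h; rewrite inE ql orbT.
apply: coprimep_expl; rewrite coprimep_sym coprimep_XsubC /root horner_prod prodf_seq_neq0.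
apply/allP => q ql; rewrite horner_exp hornerXsubC expf_neq0 // subr_eq0.
by apply: contra np => /eqP->; apply: map_f.
Qed.

Lemma size_prod_lin (l : seq triple) (tau : triple -> K) (mu : triple -> nat) :
  size (\prod_(p <- l) ('X - (tau p)%:P) ^+ mu p) = (\sum_(p <- l) mu p).+1.
Proof.
elim: l => [|p l IH]; first by rewrite !big_nil size_poly1.
rewrite !big_cons size_monicM ?monic_exp ?monicXsubC //; last first.
  by rewrite -size_poly_gt0 IH.
by rewrite IH size_exp_XsubC; lia.
Qed.

Definition drop1 (L : triple) (mu : triple -> nat) : triple -> nat :=
  fun p => (mu p - onLine L p)%N.

Definition lmul (L : triple) b (f : fv b) : fv b.+1 := ofP b.+1 (lin L * toP f).

Lemma lmul_linear (L : triple) b : linear (@lmul L b).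
Proof.
move=> c f g; rewrite /lmul toP_linear -ofP_linear; congr ofP.
by rewrite mulrDr mulrCA.
Qed.

Lemma form_lmul (L : triple) b (G : R3) : hform b G -> hform b.+1 (lin L * G).
Proof.
case: b => [|b] hG; last exact: (@formM K 1 b _ _ (form_lin L) hG).
suff -> : G = 0 by rewrite mulr0; apply: form0.
by apply/coef3P => i j k; rewrite coef3_0; apply: hG.
Qed.

Lemma toP_lmul L b f : toP (@lmul L b f) = lin L * toP f.
Proof. by rewrite ofPK //; apply/form_lmul/form_toP. Qed.

Lemma lin_neq0 (L : triple) : tnz L -> lin L != 0.
Proof.
apply: contra => /eqP e.
have E p : dot L p = 0 by rewrite -eval3_lin e eval3E rmorph0.
rewrite [L]surjective_pairing [L.1]surjective_pairing.
have := E (1,0,0); have := E (0,1,0); have := E (0,0,1).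
rewrite /dot /= !mulr0 !mulr1 !add0r !addr0 => -> -> ->.
by [].
Qed.

(** Multiplication by the form of L is injective and raises the order by one at the points of L. *)
Lemma fat_mul X mu b (L : triple) : tnz L ->
  (fdim X (drop1 L mu) b <= fdim X mu b.+1)%N.
Proof.
rewrite /fdim; move=> hL; have [h hE] := lin_hom (@lmul_linear L b).
rewrite -(limg_ker_dim h) (_ : (_ :&: _)%VS = 0%VS) ?dimv0 ?add0n; last first.
  apply/eqP; rewrite -subv0; apply/subvP => f; rewrite memv_cap memv_ker => /andP[_ /eqP].
  rewrite hE => /(congr1 (@toP K b.+1)); rewrite toP_lmul toP0 => /eqP.
  rewrite mulf_eq0 (negPf (lin_neq0 hL)) /= => /eqP e.
  by rewrite memv0; apply/eqP/toP_inj; rewrite toP0.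
apply: dimvS; apply/subvP => _ /memv_imgP[f /fatP hf ->]; apply/fatP => p pX.
by rewrite hE toP_lmul; apply/inIdeal_mull/hf.
Qed.

Definition distinct (X : seq triple) : Prop :=
  [/\ uniq X, forall p, p \in X -> tnz p & forall p q, p \in X -> q \in X -> samept p q -> p = q].

Lemma ptset_distinct (X : seq triple) : ptset X -> distinct X.
Proof.
case=> hX hd.
have idx p q : p \in X -> q \in X -> samept p q -> index p X = index q X.
  move=> pX qX s; apply: NNPP => ne; apply: (hd (index p X) (index q X)); rewrite ?index_mem //.
  by rewrite !nth_index.
split=> //.
  apply/(uniqP (0,0,0)) => i j li lj e; apply: NNPP => ne.
  apply: (hd i j li lj ne); rewrite e; exists 1; split; first exact: oner_neq0.
  by rewrite !mul1r -!surjective_pairing.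
move=> p q pX qX s; have := idx p q pX qX s => e.
by rewrite -[p](nth_index (0,0,0) pX) e nth_index.
Qed.

(** The restriction of a form to L has at most b + 1 coefficients and is divisible by the product
    [D] of the powers prescribed at the points of L. Annihilating the at most [e] coefficients of
    the quotient makes the restriction zero, so L divides the form. *)
Lemma fat_restr X mu b (L : triple) : distinct X -> tnz L ->
  (fdim X mu b.+1 <= fdim X (drop1 L mu) b +
     (b.+1 - \sum_(p <- X | onLine L p) mu p))%N.
Proof.
rewrite /fdim => -[uX hX dX] hL; set e := (b.+1 - _)%N.
have [A [B [C [a [c [h ha]]]]]] := frame_line hL hX.
pose tau p := dot c p / dot a p.
pose l := [seq p <- X | onLine L p].
pose D := \prod_(p <- l) ('X - (tau p)%:P) ^+ mu p.
have hl p : p \in l -> [/\ p \in X, dot L p = 0 & dot a p != 0].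
  by rewrite mem_filter => /andP[/eqP Lp pX]; split=> //; apply: ha.
have sD : (size D).-1 = (\sum_(p <- X | onLine L p) mu p)%N.
  by rewrite size_prod_lin big_filter.
have D0 : D != 0 by rewrite -size_poly_gt0 size_prod_lin.
have utau : uniq (map tau l).
  rewrite map_inj_in_uniq ?filter_uniq // => p q /hl[pX Lp ap] /hl[qX Lq aq] epq.
  apply: dX => //; exists (dot a q / dot a p); split; first by rewrite mulf_neq0 ?invr_eq0.
  rewrite [LHS]surjective_pairing [q.1 in LHS]surjective_pairing.
  have cq : dot c q = dot a q * (dot c p / dot a p) by rewrite -[_ / _]/(tau p) epq /tau mulrC divfK.
  rewrite [q.1.1](fr0 h) [q.1.2](fr1 h) [q.2](fr2 h) Lq.
  rewrite [p.1.1](fr0 h) [p.1.2](fr1 h) [p.2](fr2 h) Lp cq.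
  by congr (_, _, _); field.
have dvdD F : inX X mu F -> (D %| restr A B F)%R.
  by move=> hF; apply: prod_dvd => // p /hl[pX Lp ap]; apply: (restr_dvd h) => //; apply: hF.
pose phi (i : 'I_e) (f : fv b.+1) := (restr A B (toP f) %/ D)%R`_i.
have [|W [hW dW]] := @cut_functionals K _ (fat X mu b.+1) _ phi.
  by move=> i k u v; rewrite /phi toP_linear restrZ divpD divpZl coefD coefZ.
rewrite card_ord in dW; apply: leq_trans dW _; rewrite leq_add2r.
have [g gE] := lin_hom (@lmul_linear L b).
apply: (@leq_trans (\dim (g @: fat X (drop1 L mu) b)%VS)); last first.
  by rewrite -(limg_ker_dim g (fat X (drop1 L mu) b)) leq_addl.
apply: dimvS; apply/subvP => f /hW[/fatP hf f0].
have r0 : restr A B (toP f) = 0.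
  have := divpK (dvdD _ hf) => <-; suff -> : (restr A B (toP f) %/ D)%R = 0 by rewrite mul0r.
  apply/polyP => i; rewrite coef0; case: (ltnP i e) => [lt|le]; first exact: (f0 (Ordinal lt)).
  apply: nth_default; apply: leq_trans le; rewrite size_divp // sD.
  by apply: leq_sub2r; apply/size_restr/form_toP.
have [G hG eG] := restr_eq0 h (form_toP f) r0.
apply/memv_imgP; exists (ofP b G).
  apply/fatP => p pX; rewrite ofPK //; apply: (inIdeal_divl (hX _ pX) hL hG).
  by rewrite -eG; apply: hf.
by rewrite gE; apply: toP_inj; rewrite toP_lmul ofPK.
Qed.

End Dimensions.

(** * Independent conditions and lines *)

Section Regularity.
Variable K : closedFieldType.
Notation triple := (triple K).
Notation pt0 := (0 : K, 0 : K, 0 : K).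

(** Quantifying over all mu below f and all larger degrees makes the property monotone. It then also
    applies to multiplicities known only through an upper bound. *)
Definition indep_from (X : seq triple) (f : triple -> nat) (b0 : nat) : Prop :=
  forall mu b, (forall p, p \in X -> mu p <= f p)%N -> (b0 <= b)%N ->
    (fdim X mu b + \sum_(p <- X) nmon (mu p))%N = nmon b.

Lemma indep_mono X f g b0 b1 : (forall p, p \in X -> g p <= f p)%N -> (b0 <= b1)%N ->
  indep_from X f b0 -> indep_from X g b1.
Proof.
move=> hg hb h mu b hmu lb; apply: h; last exact: leq_trans lb.
by move=> p pX; apply: leq_trans (hmu p pX) (hg p pX).
Qed.

Lemma indep0 X : (forall p, p \in X -> tnz p) -> indep_from X (fun _ => 0%N) 0.
Proof.
move=> hX mu b hmu _.
have e : (\sum_(p <- X) nmon (mu p))%N = 0%N.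
  apply: big1_seq => p /andP[_ pX]; have := hmu p pX.
  by rewrite leqn0 => /eqP->; apply: nmon0.
have := fat_low mu b hX; rewrite e addn0 => le; apply/eqP; rewrite eqn_leq le andbT.
by apply: leq_trans (dimvS (subvf _)) _; rewrite dim_fv.
Qed.

(** Lowering a multiplicity from n + 1 to n saves [nmon n.+1 - nmon n], that is n + 1,
    conditions. *)
Lemma sum_drop1 (X : seq triple) mu (L : triple) :
  (\sum_(p <- X) nmon (mu p) =
   \sum_(p <- X) nmon (drop1 L mu p) + \sum_(p <- X | onLine L p) mu p)%N.
Proof.
rewrite [X in (_ + X)%N]big_mkcond -big_split /=; apply: eq_bigr => p _.
rewrite /drop1; case: (onLine L p); last by rewrite subn0 addn0.
by case: (mu p) => [|n]; rewrite ?nmon0 // subn1 nmonS.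
Qed.

Lemma step_arith (d0 d1 S0 S1 s b n n' : nat) : (d0 + S0 = n -> s <= b.+1 ->
  d1 <= d0 + (b.+1 - s) -> n' <= d1 + S1 -> S1 = S0 + s -> n' = n + b.+1 -> d1 + S1 = n')%N.
Proof. lia. Qed.

(** The bound on L makes the subtraction in [fat_restr] exact. Its upper bound for the dimension
    then meets the lower bound of [fat_low]. *)
Lemma indep_step (X : seq triple) (L : triple) f f' b0 : distinct X -> tnz L -> indep_from X f' b0 ->
  (forall p, p \in X -> f p - onLine L p <= f' p)%N ->
  (\sum_(p <- X | onLine L p) f p <= b0.+1)%N -> indep_from X f b0.+1.
Proof.
move=> dX hL h hf hs mu [|b] // hmu lb.
have hmu' p : p \in X -> (drop1 L mu p <= f' p)%N.
  by move=> pX; apply: leq_trans (hf p pX); apply/leq_sub2r/hmu.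
have E := h _ b hmu' lb.
have sle : (\sum_(p <- X | onLine L p) mu p <= b.+1)%N.
  apply: leq_trans (leq_trans hs lb); rewrite big_seq_cond [leqRHS]big_seq_cond.
  by apply: leq_sum => p /andP[pX _]; apply: hmu.
have up := fat_restr mu b dX hL.
have [_ hX _] := dX; have low := fat_low mu b.+1 hX.
have S := sum_drop1 X mu L.
have N := nmonS b.
exact: (step_arith E sle up low S N).
Qed.

(** When the multiplicities on M reach b + 1, the correction term of [fat_restr] is zero and M
    splits off. Removing M lowers the sum on another line by at most one, their common point, just
    as the degree falls by one, so the next line splits off as well. *)
Lemma first_pass (X : seq triple) mu b (Ms : seq triple) : distinct X ->
  (forall M, M \in Ms -> tnz M) ->
  (forall i j, (i < size Ms)%N -> (j < size Ms)%N -> i <> j ->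
     count (predI (onLine (nth pt0 Ms i)) (onLine (nth pt0 Ms j))) X <= 1)%N ->
  (forall M, M \in Ms -> b + size Ms <= \sum_(p <- X | onLine M p) mu p)%N ->
  fdim X mu (b + size Ms) =
  fdim X (foldl (fun nu M => drop1 M nu) mu Ms) b.
Proof.
move=> dX; elim: Ms mu => [|M Ms IH] mu hM hm hs; first by rewrite addn0.
have tM := hM M (mem_head _ _).
have sM := hs M (mem_head _ _).
rewrite /= addnS -IH.
- have up := fat_restr mu (b + size Ms) dX tM.
  have low := fat_mul X mu (b + size Ms) tM.
  by rewrite /= in sM; lia.
- by move=> M' hM'; apply: hM; rewrite inE hM' orbT.
- by move=> i j li lj ne; apply: (hm i.+1 j.+1) => // -[].
move=> M' hM'; have sM' := hs M' (mem_behead (s := M :: Ms) hM').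
have li : (index M' Ms < size Ms)%N by rewrite index_mem.
have := hm 0%N (index M' Ms).+1 isT li; rewrite /= nth_index // => /(_ ltac:(by [])) c.
have : (\sum_(p <- X | onLine M' p) mu p <=
        \sum_(p <- X | onLine M' p) drop1 M mu p + count (predI (onLine M) (onLine M')) X)%N.
  rewrite -sum1_count /= [X in (_ + X)%N](eq_bigl (fun p => onLine M' p && onLine M p)); last first.
    by move=> p /=; rewrite andbC.
  rewrite big_mkcondr -big_split /=; apply: leq_sum => p _; rewrite /drop1.
  by case: (onLine M p) => /=; lia.
by rewrite /= in sM'; lia.
Qed.

(** Points on several of the lines may drop further; a drop of one is all that the bound for the
    second pass uses. *)
Lemma foldl_drop1 mu (Ms : seq triple) p :
  (foldl (fun nu M => drop1 M nu) mu Ms p <= mu p - has (fun M => onLine M p) Ms)%N.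
Proof.
elim: Ms mu => [|M Ms IH] mu /=; first by rewrite subn0.
by apply: leq_trans (IH _) _; rewrite /drop1; case: (onLine M p) => /=; lia.
Qed.

End Regularity.

(** * Incidence of points and lines, and peeling *)

Section Geometry.
Variable K : closedFieldType.
Notation triple := (triple K).
Notation pt0 := (0 : K, 0 : K, 0 : K).

Definition cross (u v : triple) : triple :=
  (u.1.2 * v.2 - u.2 * v.1.2, u.2 * v.1.1 - u.1.1 * v.2, u.1.1 * v.1.2 - u.1.2 * v.1.1).

Lemma cross_eq0 (u v : triple) : tnz u -> tnz v -> cross u v = (0, 0, 0) -> samept u v.
Proof.
case: u v => [[a b] c] [[a' b'] c'] hu hv [] /= e1 e2 e3.
have red (k : K) : (a', b', c') = (k * a, k * b, k * c) -> samept (a, b, c) (a', b', c').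
  move=> e; exists k; split=> //; apply: contraTneq hv => k0.
  by rewrite e k0 !mul0r /tnz eqxx.
have sub x y : x - y = 0 -> x = y :> K by move=> /eqP; rewrite subr_eq0 => /eqP.
move/sub: e1 => e1; move/sub: e2 => e2; move/sub: e3 => e3.
case/tnz_cases: hu => /= nz.
- apply: (red (a' / a)); congr (_, _, _); apply: (mulfI nz); [|rewrite e3|rewrite -e2]; by field.
- apply: (red (b' / b)); congr (_, _, _); apply: (mulfI nz); [rewrite -e3| |rewrite e1]; by field.
- apply: (red (c' / c)); congr (_, _, _); apply: (mulfI nz); [rewrite e2|rewrite -e1|]; by field.
Qed.

Lemma samept_sym (u v : triple) : samept u v -> samept v u.
Proof.
case=> c [nz ->]; exists c^-1; rewrite invr_eq0; split=> //=.
by rewrite !mulKf // -!surjective_pairing.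
Qed.

Lemma samept_trans (u v w : triple) : samept u v -> samept v w -> samept u w.
Proof.
case=> c [nz ->] [d [nz' ->]]; exists (d * c); rewrite mulf_neq0 //; split=> //=.
by rewrite !mulrA.
Qed.

Lemma onLineE (l p : triple) : onLine l p = (dot l p == 0). Proof. by []. Qed.

Lemma onLine_samept (h l : triple) : samept h l -> onLine h =1 onLine l.
Proof.
case=> c [nz ->] p; rewrite !onLineE /dot /=.
have -> : c * h.1.1 * p.1.1 + c * h.1.2 * p.1.2 + c * h.2 * p.2 = c * dot h p.
  by rewrite /dot; ring.
by rewrite mulf_eq0 (negPf nz).
Qed.

(** Both points are proportional to the cross product of the two lines. *)
Lemma two_lines (h l p q : triple) : tnz h -> tnz l -> tnz p -> tnz q ->
  ~ samept h l -> onLine h p -> onLine l p -> onLine h q -> onLine l q -> samept p q.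
Proof.
move=> th tl tp tq ns hp lp hq lq.
have tw : tnz (cross h l) by apply/negP => /eqP /(cross_eq0 th tl).
have par x : tnz x -> onLine h x -> onLine l x -> samept x (cross h l).
  move=> tx /eqP hx /eqP lx; apply: cross_eq0 => //.
  case: x h l hx lx {th tl ns hp lp hq lq tw tx} => [[x y] z] [[a b] c] [[a' b'] c'] /= e e'.
  rewrite /cross /=; congr (_, _, _).
  - transitivity (a * (a' * x + b' * y + c' * z) - a' * (a * x + b * y + c * z)); first by ring.
    by rewrite e e' !mulr0 subr0.
  - transitivity (b * (a' * x + b' * y + c' * z) - b' * (a * x + b * y + c * z)); first by ring.
    by rewrite e e' !mulr0 subr0.
  - transitivity (c * (a' * x + b' * y + c' * z) - c' * (a * x + b * y + c * z)); first by ring.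
    by rewrite e e' !mulr0 subr0.
by apply: samept_trans (samept_sym _); apply: par.
Qed.

Lemma join_line (p q : triple) : tnz p -> tnz q -> ~ samept p q ->
  exists l, [/\ tnz l, onLine l p & onLine l q].
Proof.
move=> tp tq ns; exists (cross p q); split; first by apply/negP => /eqP /(cross_eq0 tp tq).
  by apply/eqP; rewrite /cross /=; ring.
by apply/eqP; rewrite /cross /=; ring.
Qed.

Lemma distinct_filter (X : seq triple) (Q : pred triple) : distinct X -> distinct (filter Q X).
Proof.
case=> uX hX dX; split; first exact: filter_uniq.
  by move=> p; rewrite mem_filter => /andP[_ /hX].
by move=> p q; rewrite !mem_filter => /andP[_ pX] /andP[_ qX]; apply: dX.
Qed.

Lemma meet_le1 (X : seq triple) (h l : triple) : distinct X -> tnz h -> tnz l -> ~ samept h l ->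
  (count (predI (onLine h) (onLine l)) X <= 1)%N.
Proof.
move=> dX th tl ns; rewrite leqNgt -size_filter; apply/negP => lt.
have [uF hF dF] := distinct_filter (predI (onLine h) (onLine l)) dX.
have := mem_nth pt0 (ltnW lt); have := mem_nth pt0 lt.
set F := filter _ X in lt uF hF dF * => m1 m0.
have on x : x \in F -> onLine h x /\ onLine l x by rewrite mem_filter => /andP[/andP[]].
have /eqP := dF _ _ m0 m1 (two_lines th tl (hF _ m0) (hF _ m1) ns (on _ m0).1 (on _ m0).2 (on _ m1).1 (on _ m1).2).
by rewrite nth_uniq // ltnW.
Qed.

Definition off (L : triple) (Y : seq triple) := [seq p <- Y | ~~ onLine L p].

(** The trace of a configuration of type (1, ..., n): lines taken from the largest down, each
    meeting what is left in exactly the prescribed number of points. *)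
Fixpoint peelable (n : nat) (Y : seq triple) : Prop :=
  if n is n'.+1 then
    exists h, [/\ tnz h, count (onLine h) Y = n & peelable n' (off h Y)]
  else Y = [::].

Lemma count_off (h : triple) (a : pred triple) Y :
  count a Y = (count a (off h Y) + count (predI (onLine h) a) Y)%N.
Proof.
rewrite /off count_filter -(count_predUI); elim: Y => //= p Y ->.
by case: (a p); case: (onLine h p) => /=; lia.
Qed.

Lemma offC h l Y : off h (off l Y) = off l (off h Y).
Proof. by rewrite /off -!filter_predI; apply: eq_filter => p /=; rewrite andbC. Qed.

Lemma size_off h Y : (size (off h Y) + count (onLine h) Y)%N = size Y.
Proof. by rewrite size_filter addnC count_predC. Qed.

(** If l differs from the first peeled line h, they share at most one point of Y, so l has at most n
    points by induction. In case of equality they share exactly one; then h has one point fewer off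
    l, and l and h can be peeled in the other order. *)
Lemma peelable_line n Y (l : triple) : distinct Y -> peelable n Y -> tnz l ->
  (count (onLine l) Y <= n)%N /\ (count (onLine l) Y = n -> peelable n.-1 (off l Y)).
Proof.
move=> dY + tl; elim: n Y dY => [|n IH] Y dY; first by move=> /= ->.
case=> h [th ch kh]; have dh := distinct_filter (fun p => ~~ onLine h p) dY.
have [le eq] := IH _ dh kh.
have [s|ns] := classic (samept h l).
  have e := onLine_samept s; rewrite -(eq_count e) ch; split=> // _ /=.
  by rewrite /off -(eq_filter (fun p => congr1 negb (e p))).
have m := meet_le1 dY th tl ns; have C := count_off h (onLine l) Y.
split; first by rewrite /off in C; lia.
move=> cl; have cn : count (onLine l) (off h Y) = n by rewrite /off in C *; lia.
have mn : count (predI (onLine h) (onLine l)) Y = 1%N by lia.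
(* With a single point in Y, removing l leaves nothing; otherwise h is the next line to peel. *)
case: n {IH} le eq kh ch cl cn C => [|n] le eq kh ch cl cn C /=.
  have := size_off l Y; have := size_off h Y; rewrite kh cl ch => /= <-.
  by case: (off l Y) => //= a s; lia.
exists h; split=> //; last by rewrite offC; apply: eq.
have e : count (predI (onLine l) (onLine h)) Y = 1%N.
  by rewrite -mn; apply: eq_count => p; apply: andbC.
by have := count_off l (onLine h) Y; rewrite ch e addn1 => -[].
Qed.

(** The last line contains no point of the earlier subsets, so it meets Y exactly in its own subset;
    removing it leaves a configuration with one line less. *)
Lemma peelable_of_lines n (Y : seq triple) (Xs : nat -> seq triple) (Ls : nat -> triple) :
  uniq Y ->
  (forall p, p \in Y -> exists2 i, (i < n)%N & p \in Xs i) ->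
  (forall i p, (i < n)%N -> p \in Xs i -> p \in Y) ->
  (forall i, (i < n)%N -> [/\ uniq (Xs i), size (Xs i) = i.+1, tnz (Ls i) &
      forall p, p \in Xs i -> onLine (Ls i) p]) ->
  (forall i j p, (j < i)%N -> (i < n)%N -> p \in Xs j -> ~~ onLine (Ls i) p) ->
  peelable n Y.
Proof.
elim: n Y => [|n IH] Y uY cov sub hX hno.
  by case: Y cov {uY sub} => // p Y /(_ p (mem_head _ _))[].
have [un sn tn onn] := hX n (ltnSn n).
exists (Ls n); split=> //.
  rewrite -size_filter -sn; apply/perm_size/uniq_perm; rewrite ?filter_uniq // => p.
  rewrite mem_filter; apply/andP/idP => [[on pY]|pX]; last by rewrite onn // (sub n).
  have [i li pX] := cov p pY; case: (ltngtP i n) => [lt||e]; last by rewrite -e.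
    by have := hno n i p lt (ltnSn n) pX; rewrite on.
  by rewrite ltnNge -ltnS li.
apply: IH.
- exact: filter_uniq.
- move=> p; rewrite mem_filter => /andP[no pY]; have [i li pX] := cov p pY.
  exists i => //; rewrite ltn_neqAle -ltnS li andbT; apply: contra no => /eqP e.
  by apply: onn; rewrite -e.
- move=> i p li pX; rewrite mem_filter (hno n i) //=; apply: sub pX.
  exact: ltnW.
- by move=> i li; apply: hX; apply: ltnW.
- by move=> i j p lj li; apply: hno => //; apply: ltnW.
Qed.

Lemma kconfig_peelable (X : seq triple) s : kconfig X (iota 1 s) -> distinct X /\ peelable s X.
Proof.
case=> /ptset_distinct dX [_ [_ [_ [Xs [Ls]]]]]; rewrite size_iota.
move=> [_ [_ [cov [sub [hX [_ hno]]]]]]; split=> //; have [uX _ _] := dX.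
apply: (@peelable_of_lines s X (nth [::] Xs) (nth pt0 Ls)) => //.
by move=> i li; have [u [e [t o]]] := hX i li; split=> //; rewrite e nth_iota.
Qed.

End Geometry.

(** * The sequence of lines *)

Section Reduction.
Variable K : closedFieldType.
Notation triple := (triple K).
Notation pt0 := (0 : K, 0 : K, 0 : K).

Local Open Scope nat_scope.

Lemma sum_excess (X : seq triple) (a : pred triple) c (e : triple -> nat) :
  \sum_(p <- X | a p) (c + e p) = c * count a X + \sum_(p <- X | a p) e p.
Proof. by rewrite big_split /= big_const_seq iter_addn_0. Qed.

Lemma sum_mull (X : seq triple) (a : pred triple) k (F : triple -> nat) :
  \sum_(p <- X | a p) k * F p = k * \sum_(p <- X | a p) F p.
Proof. by rewrite big_distrr. Qed.

Lemma sum_pred (X : seq triple) (a Q : pred triple) :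
  \sum_(p <- X | a p) Q p = count (predI a Q) X.
Proof.
by rewrite -sum1_count big_mkcondr; apply: eq_bigr => p _; case: (Q p).
Qed.

(** [indep_step] for multiplicities split into a constant c and an excess: the constant contributes
    at most c n on a line with at most n points. *)
Lemma indep_line (X : seq triple) (L : triple) c (e e' : triple -> nat) n b :
  distinct X -> tnz L -> count (onLine L) X <= n ->
  \sum_(p <- X | onLine L p) e p + c * n <= b.+1 ->
  (forall p, p \in X -> c + e p - onLine L p <= c + e' p) ->
  indep_from X (fun p => c + e' p) b -> indep_from X (fun p => c + e p) b.+1.
Proof.
move=> dX tL cn hs he h; apply: (indep_step dX tL h he).
rewrite sum_excess addnC; apply: leq_trans hs.
by rewrite leq_add2l leq_mul2l cn orbT.
Qed.

Lemma filter_off (X : seq triple) (Q : pred triple) h :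
  off h (filter Q X) = filter (predI (fun p => ~~ onLine h p) Q) X.
Proof. by rewrite /off -filter_predI. Qed.

(** One use of each peeling line raises the multiplicity by one on Q. A line carrying k new points
    comes k-th, and its sum is at most m s + k, exactly what is allowed there. *)
Lemma indep_round (X : seq triple) s m n (Q : pred triple) : distinct X ->
  (forall l, tnz l -> count (onLine l) X <= s) ->
  peelable n (filter Q X) -> indep_from X (fun _ => m) (m * s) ->
  indep_from X (fun p => m + Q p) (m * s + n).
Proof.
move=> dX hs; elim: n Q => [|n IH] Q.
  rewrite addn0 /= => e; apply: indep_mono => // p pX.
  have : p \notin filter Q X by rewrite e.
  by rewrite mem_filter pX andbT => /negPf->; rewrite addn0.
case=> h [th ch]; rewrite filter_off => kh hm; rewrite addnS.
apply: (indep_line (n := s) dX th (hs h th) _ _ (IH _ kh hm)); last first.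
  by move=> p _ /=; case: (onLine h p); case: (Q p); lia.
by rewrite sum_pred -count_filter ch; lia.
Qed.

Lemma indep_basic (X : seq triple) s m : distinct X -> peelable s X ->
  indep_from X (fun _ => m) (m * s).
Proof.
move=> dX kX; elim: m => [|m IH].
  by have [_ hX _] := dX; rewrite mul0n; apply: indep0.
rewrite mulSn addnC; have := indep_round (Q := predT) dX _ _ IH.
move=> /(_ s); rewrite filter_predT => /(_ _ kX) H.
apply: indep_mono (H _) => //; first by move=> p _ /=; lia.
by move=> l tl; have [] := peelable_line dX kX tl.
Qed.

Lemma triangle_points (Y : seq triple) h : distinct Y -> tnz h ->
  count (onLine h) Y = 2 -> peelable 1 (off h Y) ->
  exists a b c, [/\ [/\ a \in Y, b \in Y & c \in Y],
    [/\ ~~ onLine h a, onLine h b & onLine h c], b <> c &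
    forall p, p \in Y -> [\/ p = a, p = b | p = c]].
Proof.
move=> [uY _ _] th ch [h' [_ ch' k0]].
have s1 : size (off h Y) = 1 by rewrite -(size_off h') k0 ch'.
have s2 : size (filter (onLine h) Y) = 2 by rewrite size_filter.
have u2 : uniq (filter (onLine h) Y) by rewrite filter_uniq.
case E1 : (off h Y) s1 => [|a [|]] // _.
case E2 : (filter (onLine h) Y) s2 u2 => [|b [|c [|]]] // _; rewrite /= inE andbT => /eqP bc.
have m1 p : (p \in off h Y) = (p == a) by rewrite E1 inE.
have m2 p : (p \in filter (onLine h) Y) = (p == b) || (p == c) by rewrite E2 !inE.
have := m1 a; have := m2 b; have := m2 c; rewrite !mem_filter !eqxx orbT /=.
move=> /andP[hc cY] /andP[hb bY] /andP[ha aY].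
exists a, b, c; split=> // p pY; have := m1 p; have := m2 p; rewrite !mem_filter pY !andbT.
case: (onLine h p) => /=; last by move=> _ /esym/eqP; constructor 1.
by move=> /esym/orP[] /eqP -> _; [constructor 2 | constructor 3].
Qed.

Lemma sum_pred1 (X : seq triple) (a : pred triple) x : uniq X ->
  \sum_(p <- X | a p) (p == x) <= a x.
Proof.
move=> uX; rewrite (sum_pred X a (pred1 x)).
case ax : (a x); last first.
  rewrite (eq_count (a2 := pred0)) ?count_pred0 // => p /=.
  by case: eqP => [->|]; rewrite ?ax ?andbF.
apply: leq_trans (_ : count_mem x X <= _); last by rewrite count_uniq_mem // leq_b1.
by apply: sub_count => p /andP[].
Qed.

Lemma corner_arith1 m A x y : 0 < m -> y <= 1 -> x <= 1 -> x + y + A <= (A + m).+1.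
Proof. lia. Qed.

Lemma corner_arith2 m A x y z : 0 < m -> z <= 0 -> y <= 1 -> x <= 1 ->
  2 * x + y + z + A <= (A + m).+2.
Proof. lia. Qed.

(** Here [x] and [z] stand for the indicators of two distinct vertices, and [l] for incidence with
    the side joining them. *)
Lemma corner_bool1 m (x z l : bool) : (x -> l) -> (z -> l) -> ~~ (x && z) ->
  m + (x + z) - l <= m + 0.
Proof.
case: l => hx hz; first by case: x {hx}; case: z {hz} => //=; lia.
by case: x hx => [/(_ isT)//|_]; case: z hz => [/(_ isT)//|_] _; lia.
Qed.

Lemma corner_bool2 m (x y z l : bool) : (x -> l) -> (y -> l) -> ~~ (x && y) ->
  m + (2 * x + y + z) - l <= m + (x + z).
Proof.
case: l => hx hy; first by case: x {hx}; case: y {hy} => //=; lia.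
by case: x hx => [/(_ isT)//|_]; case: y hy => [/(_ isT)//|_] _; lia.
Qed.

(* Lines ab and ac: for multiplicities (2, 1, 1) above m at the vertices of a
   triangle, two lines suffice. *)
Lemma indep_corner (X : seq triple) s m h a b c : distinct X -> tnz h ->
  a \in X -> b \in X -> c \in X ->
  ~~ onLine h a -> onLine h b -> onLine h c -> b <> c -> 0 < m -> 0 < s ->
  (forall l, tnz l -> onLine l a -> count (onLine l) X <= s.-1) ->
  indep_from X (fun _ => m) (m * s) ->
  indep_from X (fun p => m + (2 * (p == a) + (p == b) + (p == c))) (m * s + 2).
Proof.
move=> dX th aX bX cX ha hb hc bc m0 s0 hl hm; have [uX tX sX] := dX.
have ab : a <> b by move=> e; rewrite e hb in ha.
have ac : a <> c by move=> e; rewrite e hc in ha.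
have ns x y : x \in X -> y \in X -> x <> y -> ~ samept x y by move=> xX yX ne sm; apply: ne; apply: sX.
have third l x y : tnz l -> onLine l a -> onLine l x -> x \in X -> y \in X -> x <> y ->
    onLine h x -> onLine h y -> onLine l y = false.
  move=> tl la lx xX yX xy hx hy; apply/negP => ly; apply: (ns x y xX yX xy).
  apply: (two_lines th tl (tX _ xX) (tX _ yX)) => // s1.
  by rewrite (onLine_samept s1) la in ha.
have [l1 [t1 l1a l1b]] := join_line (tX _ aX) (tX _ bX) (ns _ _ aX bX ab).
have [l2 [t2 l2a l2c]] := join_line (tX _ aX) (tX _ cX) (ns _ _ aX cX ac).
have l1c := third _ _ _ t1 l1a l1b bX cX bc hb hc.
(* A line through a has at most s - 1 points of X, so the constant part leaves m units to spare. One
   spare unit is enough for each side. *)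
have es : m * s = m * s.-1 + m by rewrite -{1}(prednK s0) mulnS addnC.
rewrite !addnS addn0.
have H : indep_from X (fun p => m + ((p == a) + (p == c))) (m * s).+1.
  have hm' : indep_from X (fun p => m + 0) (m * s) by apply: indep_mono hm => // p _; rewrite addn0.
  apply: (indep_line (n := s.-1) dX t2 (hl _ t2 l2a) _ _ hm').
    have := sum_pred1 (onLine l2) a uX; have := sum_pred1 (onLine l2) c uX.
    by rewrite big_split /= l2a l2c es; apply: corner_arith1 m0.
  move=> p _; apply: corner_bool1; [by move/eqP-> | by move/eqP-> |].
  by apply/negP => /andP[/eqP-> /eqP].
apply: (indep_line (n := s.-1) dX t1 (hl _ t1 l1a) _ _ H).
  have := sum_pred1 (onLine l1) a uX; have := sum_pred1 (onLine l1) b uX.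
  have := sum_pred1 (onLine l1) c uX; rewrite l1c l1a l1b.
  by rewrite big_split [X in X + _ + _]big_split sum_mull es; apply: corner_arith2 m0.
move=> p _; apply: corner_bool2; [by move/eqP-> | by move/eqP-> |].
by apply/negP => /andP[/eqP-> /eqP].
Qed.

(** Each peeling line is used twice until three points remain; their three sides then remove excess
    two at every vertex, so 2(n - 2) + 3 lines suffice. The line saved is paid for by the lines
    having at most s - 1 points, which leave m >= 1 units to spare. *)
Lemma indep_tail (X : seq triple) s m n (Q : pred triple) : distinct X ->
  (forall l p, tnz l -> p \in X -> Q p -> onLine l p -> count (onLine l) X <= s.-1) ->
  0 < m -> 0 < s -> 2 <= n -> peelable n (filter Q X) ->
  indep_from X (fun _ => m) (m * s) ->
  indep_from X (fun p => m + 2 * Q p) (m * s + (2 * n).-1).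
Proof.
move=> dX + m0 s0; have es : m * s = m * s.-1 + m by rewrite -{1}(prednK s0) mulnS addnC.
case: n => [|[|n]] // + _; elim: n Q => [|n IH] Q hQ.
  move=> [h [th ch kh]] hm.
  have [a [b [c [[aY bY cY] [ha hb hc] bc cov]]]] := triangle_points (distinct_filter Q dX) th ch kh.
  move: aY bY cY; rewrite !mem_filter => /andP[Qa aX] /andP[Qb bX] /andP[Qc cX].
  (* The side h brings the excesses (2, 2, 2) down to (2, 1, 1), where the other two sides take
     over. *)
  rewrite -[(2 * 2).-1]/(2.+1) addnS.
  have H := indep_corner dX th aX bX cX ha hb hc bc m0 s0 (fun l tl => hQ l a tl aX Qa) hm.
  apply: (indep_line (n := s.-1) dX th (hQ h b th bX Qb hb) _ _ H).
    by rewrite sum_mull sum_pred -count_filter ch es; clear -m0; move: (m * s.-1); lia.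
  move=> p pX; case Qp : (Q p) => /=; last by clear; lia.
  have pY : p \in filter Q X by rewrite mem_filter Qp.
  case: (cov p pY) => ->.
  - by rewrite eqxx; clear; lia.
  - by rewrite eqxx hb; clear; lia.
  - by rewrite eqxx hc; clear; lia.
case=> h [th ch kh] hm; rewrite filter_off in kh.
have ch' : count (onLine h) X <= s.-1.
  have : has (onLine h) (filter Q X) by rewrite has_count ch.
  by move=> /hasP[p]; rewrite mem_filter => /andP[Qp pX] hp; apply: hQ hp.
have {}IH := IH _ (fun l p tl pX Qp => hQ l p tl pX (andP Qp).2) kh hm.
pose Q' : pred triple := predI (fun p => ~~ onLine h p) Q.
have -> : m * s + (2 * n.+3).-1 = (m * s + (2 * n.+2).-1).+2 by clear; lia.
(* The stage between the two uses of h: the points of Q on h have excess one. *)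
have H : indep_from X (fun p => m + (2 * Q' p + (onLine h p && Q p))) (m * s + (2 * n.+2).-1).+1.
  apply: (indep_line (n := s.-1) dX th ch' _ _ IH).
    rewrite big_split /= sum_mull sum_pred (sum_pred X _ (predI (onLine h) Q)).
    have -> : count (predI (onLine h) Q') X = 0.
      by rewrite (eq_count (a2 := pred0)) ?count_pred0 // => p; rewrite /Q' /=; case: (onLine h p).
    have -> : count (predI (onLine h) (predI (onLine h) Q)) X = n.+3.
      by rewrite -ch count_filter; apply: eq_count => p /=; case: (onLine h p).
    by rewrite es; clear -m0; move: (m * s.-1); lia.
  by move=> p _; rewrite /Q' /=; case: (onLine h p); case: (Q p) => /=; clear; lia.
apply: (indep_line (n := s.-1) dX th ch' _ _ H).
  by rewrite sum_mull sum_pred -count_filter ch es; clear -m0; move: (m * s.-1); lia.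
by move=> p _; rewrite /Q' /=; case: (onLine h p); case: (Q p) => /=; clear; lia.
Qed.

Definition onAny (Ls : seq triple) (p : triple) := has (fun l => onLine l p) Ls.
Definition offAll (Ls X : seq triple) := [seq p <- X | ~~ onAny Ls p].

Lemma offAll_rcons Ls l X : offAll (rcons Ls l) X = off l (offAll Ls X).
Proof.
rewrite /offAll /off -filter_predI; apply: eq_filter => p /=.
by rewrite /onAny -cats1 has_cat /= orbF negb_or andbC.
Qed.

(** Each removed line takes at most one point away from l. *)
Lemma count_offAll Ls (l : triple) X : distinct X -> tnz l ->
  (forall M, M \in Ls -> tnz M /\ ~ samept M l) ->
  count (onLine l) X <= count (onLine l) (offAll Ls X) + size Ls.
Proof.
move=> dX tl; elim/last_ind: Ls => [|Ls M IH] hM.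
  by rewrite /offAll filter_predT addn0.
have hM' M' : M' \in Ls -> tnz M' /\ ~ samept M' l.
  by move=> h; apply: hM; rewrite mem_rcons inE h orbT.
have [tM nM] := hM M ltac:(by rewrite mem_rcons mem_head).
apply: leq_trans (IH hM') _; rewrite offAll_rcons size_rcons.
rewrite (count_off M (onLine l) (offAll Ls X)) -addnA leq_add2l addnC -addn1 leq_add2l.
by apply: meet_le1 => //; apply: distinct_filter.
Qed.

(** After j rich lines are removed, the next one keeps at least s - j points by [count_offAll] and
    at most s - j by [peelable_line]. Equality allows the peeling to continue with it. *)
Lemma rich_chain (X Ls : seq triple) s : distinct X -> peelable s X -> size Ls < s ->
  (forall l, l \in Ls -> tnz l /\ count (onLine l) X = s) ->
  (forall i j, i < size Ls -> j < size Ls -> i <> j -> ~ samept (nth pt0 Ls i) (nth pt0 Ls j)) ->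
  (forall j, j <= size Ls -> peelable (s - j) (offAll (take j Ls) X)) /\
  (forall j, j < size Ls -> count (onLine (nth pt0 Ls j)) (offAll (take j Ls) X) = s - j).
Proof.
move=> dX kX ls hL nL.
have cj j : j < size Ls -> peelable (s - j) (offAll (take j Ls) X) ->
    count (onLine (nth pt0 Ls j)) (offAll (take j Ls) X) = s - j.
  move=> lj kj; have [tl cl] := hL _ (mem_nth pt0 lj).
  have [le _] := peelable_line (distinct_filter _ dX) kj tl.
  have : forall M, M \in take j Ls -> tnz M /\ ~ samept M (nth pt0 Ls j).
    move=> M hM; split; first by have [] := hL M (mem_take hM).
    move: hM => /(nthP pt0)[i]; rewrite size_takel; last exact: ltnW.
    move=> li <-; rewrite nth_take //; apply: nL => //; first exact: ltn_trans li lj.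
    by move=> e; rewrite e ltnn in li.
  move=> /(count_offAll dX tl); rewrite cl size_takel; last exact: ltnW.
  by move=> ge; apply/eqP; rewrite eqn_leq leq_subLR addnC ge andbT; apply: le.
suff kj j : j <= size Ls -> peelable (s - j) (offAll (take j Ls) X).
  by split=> // j lj; apply: cj => //; apply/kj/ltnW.
elim: j => [|j IH] lj; first by rewrite take0 /offAll filter_predT subn0.
have kj := IH (ltnW lj); have [tl _] := hL _ (mem_nth pt0 lj).
have [_ H] := peelable_line (distinct_filter _ dX) kj tl.
by rewrite (take_nth pt0 lj) offAll_rcons subnS; apply/H/cj.
Qed.

(** On the rich line of index j the excess is one at the s - j points off the earlier rich lines and
    zero elsewhere. This fits the degree because there are fewer than s rich lines. *)
Lemma second_pass (X Ls : seq triple) s m j : distinct X ->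
  size Ls < s -> j <= size Ls ->
  (forall l, l \in Ls -> tnz l /\ count (onLine l) X = s) ->
  (forall i, i < size Ls -> count (onLine (nth pt0 Ls i)) (offAll (take i Ls) X) = s - i) ->
  indep_from X (fun p => m + (~~ onAny (take j Ls) p + ~~ onAny Ls p)) (m * s + (s + s - 1 - size Ls - j)) ->
  indep_from X (fun p => m + (1 + ~~ onAny Ls p)) (m * s + (s + s - 1 - size Ls)).
Proof.
move=> dX ls + hL cL; elim: j => [|j IH] lj.
  by rewrite subn0; apply: indep_mono => // p _; rewrite take0.
move=> h; apply: (IH (ltnW lj)); set L := nth pt0 Ls j.
have mL : L \in Ls by apply: mem_nth.
have [tL cl] := hL _ mL.
have -> : m * s + (s + s - 1 - size Ls - j) = (m * s + (s + s - 1 - size Ls - j.+1)).+1 by lia.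
apply: (indep_line (n := s) dX tL _ _ _ h); first by rewrite cl.
  rewrite big_split /= sum_pred (sum_pred X _ (fun p => ~~ onAny Ls p)).
  rewrite -count_filter -/(offAll _ _) cL // (eq_count (a2 := pred0)) ?count_pred0.
    by lia.
  by move=> p /=; apply/negP => /andP[Lp /hasP]; apply; exists L.
move=> p _; rewrite (take_nth pt0 lj) /onAny -cats1 has_cat /= orbF -/L -!/(onAny _ _).
case Lp : (onLine L p); last by rewrite orbF subn0.
have -> : onAny Ls p by apply/hasP; exists L.
by rewrite orbT /=; case: (onAny _ p) => /=; lia.
Qed.

Lemma indep_rich (X Ls : seq triple) s m : distinct X -> peelable s X ->
  0 < size Ls < s ->
  (forall l, l \in Ls -> tnz l /\ count (onLine l) X = s) ->
  (forall i j, i < size Ls -> j < size Ls -> i <> j -> ~ samept (nth pt0 Ls i) (nth pt0 Ls j)) ->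
  (forall l, tnz l -> count (onLine l) X = s -> exists2 l', l' \in Ls & samept l' l) ->
  0 < m ->
  indep_from X (fun p => m + (1 + ~~ onAny Ls p)) (m * s + (s + s - 1 - size Ls)).
Proof.
move=> dX kX /andP[r0 rs] hL nL all m0.
have [ks cs] := rich_chain dX kX rs hL nL.
have hm : indep_from X (fun _ => m) (m * s) by apply: indep_basic.
(* A line with s points is rich up to proportionality, so a line through a point off all rich lines
   has at most s - 1 points. *)
have poor l p : tnz l -> ~~ onAny Ls p -> onLine l p -> count (onLine l) X <= s.-1.
  move=> tl np lp; have [le _] := peelable_line dX kX tl.
  suff ne : count (onLine l) X != s by rewrite -ltnS prednK ?(ltn_trans r0) // ltn_neqAle ne.
  apply: contra np => /eqP /(all l tl)[l' hl' sl]; apply/hasP; exists l' => //.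
  by rewrite (onLine_samept sl).
(* If the points off the rich lines need at least two peeling lines, [indep_tail] applies to them
   after a full second pass. *)
have [r2|r1] := leqP (size Ls + 2) s.
  apply: (second_pass (j := size Ls) dX rs (leqnn _) hL cs).
  have kr := ks _ (leqnn _); rewrite take_size in kr *.
  have H := indep_tail dX (fun l p tl pX => poor l p tl) m0 (ltn_trans r0 rs) _ kr hm.
  apply: indep_mono (H _); [|lia|lia].
  by move=> p _; lia.
have er : s = (size Ls).+1 by lia.
have lt : s - 2 < size Ls by lia.
(* Only one point lies off all s - 1 rich lines. The second pass therefore stops before the last
   rich line, whose two remaining points form with it a triangle with excesses (2, 1, 1). *)
apply: (second_pass (j := s - 2) dX rs (ltnW lt) hL cs).
set h := nth pt0 Ls (s - 2); have mh : h \in Ls by apply: mem_nth.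
have [th _] := hL _ mh.
set Y := offAll (take (s - 2) Ls) X.
have tk : rcons (take (s - 2) Ls) h = Ls.
  by rewrite -take_nth // (_ : (s - 2).+1 = size Ls) ?take_size //; lia.
have ch : count (onLine h) Y = 2 by rewrite cs //; lia.
have kh : peelable 1 (off h Y).
  rewrite /Y -offAll_rcons tk; have := ks _ (leqnn _); rewrite take_size.
  by rewrite (_ : s - size Ls = 1) //; lia.
have [a [b [c [[aY bY cY] [ha hb hc] bc cov]]]] := triangle_points (distinct_filter _ dX) th ch kh.
have na : ~~ onAny Ls a.
  move: aY; rewrite mem_filter => /andP[aY _].
  by rewrite -tk /onAny -cats1 has_cat /= orbF negb_or -/(onAny _ _) aY.
move: aY bY cY; rewrite !mem_filter => /andP[_ aX] /andP[_ bX] /andP[_ cX].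
have := indep_corner dX th aX bX cX ha hb hc bc m0 (ltn_trans r0 rs)
  (fun l tl => poor l a tl na) hm.
apply: indep_mono; last by lia.
move=> p pX; rewrite leq_add2l.
have on q : onLine h q -> onAny Ls q by move=> hq; apply/hasP; exists h.
case tp : (onAny (take (s - 2) Ls) p) => /=.
  have -> // : onAny Ls p by rewrite -tk /onAny -cats1 has_cat -/(onAny _ _) tp.
have pY : p \in Y by rewrite mem_filter tp.
case: (cov p pY) => ->.
- by rewrite eqxx; clear; case: onAny; lia.
- by rewrite eqxx (on _ hb); clear; lia.
- by rewrite eqxx (on _ hc); clear; lia.
Qed.

End Reduction.

(** * Hilbert functions and the conclusion *)

Section Hilbert.
Variable K : closedFieldType.
Local Open Scope nat_scope.

Lemma HFE (X : seq (triple K)) m t :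
  HF (inIfat X m) t = nmon t.+1 - fdim X (fun _ => m) t.+1.
Proof.
rewrite /HF (dimdegE (U := fullv)) ?dim_fv; last first.
- by move=> f; split=> _; [apply/homog_form/form_toP | rewrite memvf].
- by move=> F hF; apply/homog_form.
congr (_ - _); apply: dimdegE; first by move=> F [hF _]; apply/homog_form.
move=> f; split=> [/fatP h|[_ h]]; last exact/fatP.
by split=> //; apply/homog_form/form_toP.
Qed.

Lemma final_arith b q S (x1 x2 d1 d2 n1 n2 k1 k2 : nat) :
  x1 + S = n1 -> x2 + S = n2 -> d1 = x1 -> d2 = x2 -> n2 = n1 + b.+2 ->
  k2 = k1 + (b + q).+2 -> d1 <= k1 -> d2 <= k2 ->
  ((k2 - d2)%N%:Z - (k1 - d1)%N%:Z)%R = q%:Z.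
Proof. lia. Qed.

End Hilbert.

Theorem theorem4p7 (K : closedFieldType) (X : seq (triple K)) (s r : nat) :
  (2 <= s)%N ->
  kconfig X (iota 1 s) ->
  exactly_lines_with X s r ->
  (1 <= r)%N -> (r < s)%N ->
  forall m : nat, (s.+1 <= m)%N ->
    DeltaHF (inIfat X m) (m * s - 1) = r%:Z.
Proof.
move=> s2 /kconfig_peelable[dX kX] [Ls [sz [hL [nL all]]]] r1 rs m ms.
rewrite -{r}sz in nL r1 rs *.
(* Base multiplicity m - 2: the excess is one on the rich lines and two elsewhere, which bounds what
   the first pass leaves. *)
have R := @indep_rich K X Ls s (m - 2) dX kX (introT andP (conj r1 rs)) hL nL all ltac:(lia).
set mu := fun _ : triple K => m.
pose nu := foldl (fun nu M => drop1 M nu) mu Ls.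
set q := size Ls in R r1 rs nL *.
(* Every rich line carries total multiplicity m s, so all of them split off as long as the shifted
   degree is at most m s. *)
have D b : (b + q <= m * s)%N -> fdim X mu (b + q) = fdim X nu b.
  move=> lb; apply: first_pass => //; first by move=> M /hL[].
    move=> i j li lj ne; apply: meet_le1 => //; last exact: nL.
      by have [] := hL _ (mem_nth (0, 0, 0) li).
    by have [] := hL _ (mem_nth (0, 0, 0) lj).
  move=> M hM; apply: leq_trans lb _.
  by rewrite big_const_seq iter_addn_0 -/(nOnLine X M) (hL M hM).2.
have I b : ((m - 2) * s + (s + s - 1 - q) <= b)%N ->
    (fdim X nu b + \sum_(p <- X) nmon (nu p))%N = nmon b.
  move=> lb; apply: R => // p _; apply: leq_trans (foldl_drop1 _ _ _) _.
  by rewrite /onAny /mu; case: has => /=; lia.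
have le b : (fdim X mu b <= nmon b)%N.
  by apply: leq_trans (dimvS (subvf _)) _; rewrite dim_fv.
(* With this b the degrees m s - 2 and m s - 1 have shifted values b + 1 + q and b + 2 + q. *)
have : exists b, (m * s = b + q + 2)%N by exists (m * s - q - 2)%N; nia.
case=> b eb.
(* Equality holds here: independence starts exactly at the lower of the two degrees. *)
have lb : ((m - 2) * s + (s + s - 1 - q) <= b.+1)%N by rewrite mulnBl; nia.
have D1 := D b.+1 ltac:(lia); have D2 := D b.+2 ltac:(lia).
have I1 := I b.+1 lb; have I2 := I b.+2 (leqW lb).
rewrite (_ : (m * s - 1 = (b + q).+1)%N); last by lia.
rewrite /DeltaHF !HFE -/mu; rewrite !addSn in D1 D2.
have N1 := nmonS b.+1; have N2 := nmonS (b + q).+1.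
have L1 := le (b + q).+1; have L2 := le (b + q).+2.
(* The conditions imposed by [nu] are the same in both degrees and cancel, leaving (b + q + 2) - (b
   + 2) = q. *)
exact: (final_arith I1 I2 D1 D2 N1 N2 L1 L2).
Qed.
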